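(* Let $(G_\sigma)_{\sigma\ge1}$ and $X$ be as in the context, with $G_\sigma(\{1\})=0$ for all $\sigma>1$. Assume that $\beta=0$. For any polynomial $f$ and any $s>0$, $$A_sf(x)=\frac{x}{2s}f'(x)+\frac{1}{2s}\int_{\mathbb{R}}\big[f(x+y)-f(x)\big]\int_0^{\infty}\phi\big((e^{-\omega/2}-1)x,\;s(1-e^{-\omega}),\;y\big)\,\nu(d\omega)\,dy .$$
   Context: $\phi(\mu,v,\cdot)$ is the density of the Gaussian distribution with mean $\mu$ and variance $v$. A family $(G_\sigma)_{\sigma\ge1}$ of probability measures on $[0,1]$ is a log-convolution semi-group if, for all $\sigma,\tau\ge1$, the product of two independent random variables with distributions $G_\sigma$ and $G_\tau$ has distribution $G_{\sigma\tau}$. It has Laplace exponent $\psi(\lambda)=\beta\lambda+\int_0^\infty(1-e^{-\lambda x})\nu(dx)$ if, for $R_\sigma$ distributed as $G_\sigma$, $L_\sigma(\lambda):=\mathbb{E}[(R_\sigma)^\lambda]=\sigma^{-\psi(\lambda)}$ for all $\sigma\ge1$, $\lambda>0$, where $\beta\ge0$ and $\nu$ is a measure on $[0,\infty)$ with $\nu(\{0\})=0$ and $\int_0^\infty(1\wedge x)\nu(dx)<\infty$. Standing setting: $(G_\sigma)_{\sigma\ge1}$ is a log-convolution semi-group with Laplace exponent $\psi$ satisfying $\psi(1/2)=1$. $X$ is the Markov martingale with $X_0=0$ whose transition probabilities for $0<s<t$, with $\sigma=\sqrt{t/s}$, are (since $G_\sigma(\{1\})=0$) $$P_{s,t}(x,dy)=\left(\int_{[0,1)}\phi\big(\sigma\sqrt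 r\,x,\;t(1-r),\;y\big)\,G_\sigma(dr)\right)dy,$$ and $P_{0,t}(x,dy)=\phi(x,t,y)\,dy$. The infinitesimal generator is $A_sf(x)=\lim_{t\downarrow s}\frac{1}{t-s}\left(\int f(y)P_{s,t}(x,dy)-f(x)\right)$, $x\in\mathbb{R}$.
   Formalization: The integral over y is read as the limit, as e tends to 0+, of integrals over |y| >= e, because the Lebesgue integral is undefined for some ν (e.g. stable with index in [1/2,1)); the two agree whenever the integrand is Lebesgue integrable. *)

(* Defs.v *)
From HB Require Import structures.
From mathcomp Require Import all_boot all_order all_algebra.
From mathcomp Require Import all_classical all_reals all_analysis.
From mathcomp Require Import measurable_realfun.

Set Implicit Arguments.
Unset Strict Implicit.
Unset Printing Implicit Defensive.

Import Order.TTheory GRing.Theory Num.Theory.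
Import numFieldNormedType.Exports.

Local Open Scope classical_set_scope.
Local Open Scope ring_scope.

Section LogConvolution.
Context {R : realType}.
Implicit Types (G : R -> probability (measurableTypeR R) R) (sigma tau : R).

(* The product of two independent variables with laws G sigma and G tau has as
   its law the image of the product measure under multiplication. *)
Definition log_convolution_semigroup G : Prop :=
  (forall sigma, 1 <= sigma -> G sigma `[0, 1]%classic = 1%E) /\
  (forall sigma tau, 1 <= sigma -> 1 <= tau ->
    forall A : set (measurableTypeR R), measurable A ->
      (G sigma \x G tau)%E [set p | A (p.1 * p.2)] = G (sigma * tau) A).

Definition levy_pair (beta : R)
    (nu : {measure set (measurableTypeR R) -> \bar R}) : Prop :=
  [/\ 0 <= beta, nu `]-oo, 0[%classic = 0%E, nu [set 0] = 0%E &
      (\int[nu]_(x in `[0%R, +oo[) (Num.min 1 x)%:E < +oo)%E].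

Definition bernstein_fun (beta : R)
    (nu : {measure set (measurableTypeR R) -> \bar R}) (lambda : R) : R :=
  beta * lambda + \int[nu]_(x in `[0, +oo[) (1 - expR (- (lambda * x))).

Definition has_laplace_exponent G (psi : R -> R) : Prop :=
  forall sigma lambda, 1 <= sigma -> 0 < lambda ->
    (\int[G sigma]_(r in `[0%R, 1%R]) (r `^ lambda)%:E)%E
      = (sigma `^ (- psi lambda))%:E.

End LogConvolution.

Section Transition.
Context {R : realType}.
Variable G : R -> probability (measurableTypeR R) R.

(* The second parameter of [normal_pdf] is the standard deviation; [v] here is
   the variance and is positive wherever [gauss] contributes below. *)
Definition gauss (m v y : R) : R := normal_pdf m (Num.sqrt v) y.

(* Extended-real valued: for fixed y the mixture over r can be infinite, since
   the variance t(1-r) vanishes as r tends to 1; it is finite for almost every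
   y. *)
Definition transition_density (s t x y : R) : \bar R :=
  if s == 0 then (gauss x t y)%:E else
  let sigma := Num.sqrt (t / s) in
  (\int[G sigma]_(r in `[0%R, 1%R[)
     (gauss (sigma * Num.sqrt r * x) (t * (1 - r)) y)%:E)%E.

Definition transition (s t x : R) (B : set (measurableTypeR R)) : \bar R :=
  (\int[lebesgue_measure]_(y in B) transition_density s t x y)%E.

Definition transition_op (s t : R) (f : R -> R) (x : R) : \bar R :=
  (\int[lebesgue_measure]_y ((f y)%:E * transition_density s t x y))%E.

(* "The limit defining A_s f(x) exists and equals a." *)
Definition generator_is (s : R) (f : R -> R) (x a : R) : Prop :=
  (((t - s)^-1)%:E * (transition_op s t f x - (f x)%:E))%E
    @[t --> s^'+] --> a%:E.

Section Process.
Context {d : measure_display} {T : measurableType d}.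
Variables (P : probability T R) (X : R -> {RV P >-> R}).

Definition past (s : R) : set (set T) :=
  <<s [set A | exists u (B : set (measurableTypeR R)),
         [/\ 0 <= u, u <= s, measurable B & A = X u @^-1` B]] >>.

Definition markov_process : Prop :=
  forall s t, 0 <= s -> s < t ->
  forall (A : set T) (B : set (measurableTypeR R)), past s A -> measurable B ->
    P (A `&` X t @^-1` B) = (\int[P]_(w in A) transition s t (X s w) B)%E.

Definition martingale : Prop :=
  (forall t, 0 <= t -> P.-integrable setT (EFin \o X t)) /\
  (forall s t, 0 <= s -> s <= t -> forall A : set T, past s A ->
    (\int[P]_(w in A) (X t w)%:E = \int[P]_(w in A) (X s w)%:E)%E).

Definition markov_martingale : Prop :=
  [/\ {ae P, forall w, X 0 w = 0}, markov_process & martingale].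

End Process.
End Transition.

Section JumpKernel.
Context {R : realType}.

Definition jump_density (nu : {measure set (measurableTypeR R) -> \bar R})
    (s x y : R) : \bar R :=
  (\int[nu]_(w in `[0%R, +oo[)
     (gauss ((expR (- w / 2) - 1) * x) (s * (1 - expR (- w))) y)%:E)%E.

(* When int (1 /\ sqrt w) nu(dw) is infinite, (f(x+y) - f(x)) * jump_density
   is not Lebesgue integrable near y = 0 unless f'(x) = 0 (take
   nu(dw) = w^(-1-a) dw with 1/2 <= a < 1), so the integral over y has to be
   read as an integral with a singularity at 0.  It is the Lebesgue integral
   whenever g is Lebesgue integrable: see [integral_off0E]. *)
Definition integral_off0 (g : R -> \bar R) (J : R) : Prop :=
  (forall e : R, 0 < e ->
    (@lebesgue_measure R).-integrable [set y | e <= `|y|] g) /\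
  (\int[lebesgue_measure]_(y in [set y | (e <= `|y|)%R]) g y)%E
    @[e --> 0^'+] --> J%:E.

Lemma integral_off0E (g : measurableTypeR R -> \bar R) (J : R) :
  integral_off0 g J -> (@lebesgue_measure R).-integrable setT g ->
  (\int[lebesgue_measure]_y g y)%E = J%:E.
Proof.
move=> [_ gJ] ig.
pose D (n : nat) : set (measurableTypeR R) := [set y | n.+1%:R^-1 <= `|y|].
have mD n : measurable (D n).
  rewrite (_ : D n = setT `&` (@Num.norm _ R) @^-1` `[n.+1%:R^-1, +oo[).
    exact: (@normr_measurable R setT).
  by apply/seteqP; split => y; rewrite /D/= in_itv/= andbT; [|case].
have seqJ : (\int[lebesgue_measure]_(y in D n) g y)%E @[n --> \oo] --> J%:E.
  apply: (cvg_comp (fun n => n.+1%:R^-1 : R) _ _ gJ).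
  move=> A [e /= e0 eA].
  have [N _ NA] := (cvgr0Pnorm_lt _).1 (@cvg_harmonic R) _ e0.
  exists N => // n /= Nn; apply: eA; last by rewrite invr_gt0.
  by rewrite /= sub0r normrN; exact: NA.
have mg := measurable_int _ ig.
pose T : measurableType _ := measurableTypeR R.
pose gn (n : nat) : T -> \bar R := g \_ (D n).
have gr n : measurable_fun [set: T] (gn n).
  by apply/(measurable_restrictT _ (mD n)); exact: measurable_funTS.
have ae0 : {ae (@lebesgue_measure R), forall y : T, setT y ->
    gn n y @[n --> \oo] --> g y}.
  exists [set 0]; split => //; first exact: lebesgue_measure_set1.
  apply: subsetCl => y /= /eqP y0 _.
  have [N _ NA] := (cvgr0Pnorm_lt _).1 (@cvg_harmonic R) `|y|
    ltac:(by rewrite normr_gt0).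
  apply: cvg_near_cst; exists N => // n /= Nn.
  rewrite /gn patchE mem_set// /D/=; apply/ltW.
  by have := NA n Nn; rewrite /harmonic/= ger0_norm ?invr_ge0.
have normr_patch y n : (`|gn n y| <= `|g y|)%E.
  by rewrite /gn patchE; case: ifP => // _; rewrite abse0.
have [_ _ Dg] := dominated_convergence measurableT gr mg ae0
  (integrable_abse ig) (aeW _ (fun y n _ => normr_patch y n)).
have gE : (fun n => \int[lebesgue_measure]_x gn n x)%E
    = (fun n => \int[lebesgue_measure]_(x in D n) g x)%E.
  by apply/funext => n; rewrite -integral_mkcond.
rewrite gE in Dg.
exact: (cvg_unique _ Dg seqJ).
Qed.

End JumpKernel.

(* Main.v *)
(* Write r = sqrt of the G_sigma-variable.  Since t = sigma^2 s, the law
   N(sigma r x, t (1 - r^2)) is the image of N(r x, s (1 - r^2)) under scaling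
   by sigma, so P_{s,t} maps y^n to sigma^n E[B_n(r)], where the moment B_n is a
   polynomial in r that does not depend on t and B_n(1) = x^n.  As
   E[r^j] = sigma^(- psi (j/2)), P_{s,t} f (x) is a finite combination of powers
   of t / s and can be differentiated at t = s.  The terms psi (j/2) recombine
   into J = int (E f(x + Y_w) - f(x)) nu(dw), where Y_w is normal with mean
   (e^(-w/2) - 1) x and variance s (1 - e^(-w)).

   To exchange the integrals over y and w away from y = 0, and to let the
   truncation |y| >= e tend to 0 by dominated convergence, one needs
   E[f(x + Y_w) - f(x); |Y_w| >= e] = O(min(1, w)) uniformly in e.  The part of
   f(x + y) - f(x) of order y^2 is controlled by |Y_w|^2 <= min(1, w) (|x| +
   sqrt s |Z|)^2; the linear part by |E[Y_w; |Y_w| >= e]| <= |E Y_w|. *)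
Require Import Defs.
From HB Require Import structures.
From mathcomp Require Import all_boot all_order all_algebra.
From mathcomp Require Import all_classical all_reals all_analysis.
From mathcomp Require Import measurable_realfun.
From mathcomp Require Import ring lra.

Set Implicit Arguments.
Unset Strict Implicit.
Unset Printing Implicit Defensive.

Import Order.TTheory GRing.Theory Num.Theory.
Import numFieldNormedType.Exports.

Local Open Scope classical_set_scope.
Local Open Scope ring_scope.

(** * Gaussian densities and expectations under the standard normal law *)

Section Gaussian.
Context {R : realType}.
Notation mu := (@lebesgue_measure R).
Implicit Types (h : R -> R) (m v : R).

(** Lebesgue measure is determined by its values on the intervals []c, d]]. There it agrees with [a]
    times its image under [z -> m + a * z], since the preimage of []c, d]] has length
    [(d - c) / a]. *)
Let ge0_integral_affine (m a : R) (g : measurableTypeR R -> \bar R) : 0 < a ->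
  measurable_fun setT g -> (forall y, 0 <= g y)%E ->
  (\int[mu]_y g y = \int[mu]_z (a%:E * g (m + a * z)%R))%E.
Proof.
move=> a0 mg g0.
pose phi : measurableTypeR R -> measurableTypeR R := fun z => m + a * z.
have mphi : measurable_fun setT phi.
  by apply: measurable_funD => //; exact: measurable_funM.
pose k : {nonneg R} := NngNum (ltW a0).
pose nuf := (mscale k (pushforward mu phi) :
  {measure set (measurableTypeR R) -> \bar R}).
pose nu := nuf mphi.
have munu A : measurable A -> mu A = nu A.
  move=> mA; apply: lebesgue_measure_unique => // _ [[c d]] _ <-.
  rewrite /nu/= /mscale/= /pushforward.
  have -> : phi @^-1` [set` Interval (BRight c) (BRight d)] =
      [set` Interval (BRight ((c - m) / a)) (BRight ((d - m) / a))].
    apply/seteqP; split => z /=; rewrite /phi !in_itv/=.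
      by rewrite ltr_pdivrMr// ler_pdivlMr// mulrC ltrBlDl lerBrDl.
    by rewrite ltr_pdivrMr// ler_pdivlMr// mulrC ltrBlDl lerBrDl.
  rewrite !lebesgue_measure_itv/= !lte_fin ltr_pM2r ?invr_gt0// ltrD2r.
  case: ifPn => _; last by rewrite mule0.
  rewrite -!EFinB -EFinM; congr EFin.
  by field; rewrite gt_eqF.
rewrite ge0_integralZl//; last 2 first.
  exact: (measurableT_comp mg mphi).
  by rewrite lee_fin ltW.
  transitivity (\int[nu]_y g y)%E.
    by apply: eq_measure_integral => A mA _; exact: munu.
  rewrite /nu ge0_integral_mscale//=; congr (_ * _)%E.
  by rewrite ge0_integral_pushforward.
Qed.

(** Positive and negative parts are transported separately, so the identity holds in the extended
    reals without integrability of [g]. *)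
Lemma integral_affine (m a : R) (g : R -> R) : 0 < a ->
  measurable_fun setT g ->
  (\int[mu]_y (g y)%:E = \int[mu]_z (a * g (m + a * z)%R)%:E)%E.
Proof.
move=> a0 mg.
have mgp : measurable_fun setT (g^\+)%R by exact: measurable_funrpos.
have mgn : measurable_fun setT (g^\-)%R by exact: measurable_funrneg.
rewrite integralE [RHS]integralE.
congr (_ - _)%E.
  rewrite (@ge0_integral_affine m a)//=; last first.
    by apply: measurable_funepos; exact/measurable_EFinP.
  apply: eq_integral => z _.
  by rewrite !funeposE/= -!EFin_max -EFinM maxr_pMr ?mulr0// ltW.
rewrite (@ge0_integral_affine m a)//=; last first.
  by apply: measurable_funeneg; exact/measurable_EFinP.
apply: eq_integral => z _.
by rewrite !funenegE/= -!EFin_max -EFinM maxr_pMr ?mulr0 ?mulrN// ltW.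
Qed.

Lemma integralN_arg (g : R -> R) : measurable_fun setT g ->
  (\int[mu]_y (g y)%:E = \int[mu]_y (g (- y)%R)%:E)%E.
Proof.
have ge0 (k : measurableTypeR R -> \bar R) : measurable_fun setT k ->
    (forall y, 0 <= k y)%E -> (\int[mu]_y k y = \int[mu]_y k (- y)%R)%E.
  move=> mk k0; have mN : measurable_fun setT
      (-%R : measurableTypeR R -> measurableTypeR R) by exact: oppr_measurable.
  have := @ge0_integral_pushforward _ _ _ _ _ _ mN mu setT k measurableT mk
    (fun y _ => k0 y).
  rewrite preimage_setT => <-.
  by apply: eq_measure_integral => A mA _; exact/esym/lebesgue_measureN.
move=> mg; rewrite integralE [RHS]integralE; congr (_ - _)%E.
  rewrite (ge0 (EFin \o g)^\+%E)//; last first.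
    by apply: measurable_funepos; exact/measurable_EFinP.
  by apply: eq_integral => z _; rewrite !funeposE.
rewrite (ge0 (EFin \o g)^\-%E)//; last first.
  by apply: measurable_funeneg; exact/measurable_EFinP.
by apply: eq_integral => z _; rewrite !funenegE.
Qed.

(* Unlike [gauss], it vanishes for nonpositive variances, so that the mixtures
   below may be taken over the whole line. *)
Definition gpdf m v y : R := if 0 < v then gauss m v y else 0.

Lemma gpdf_ge0 m v y : 0 <= gpdf m v y.
Proof. by rewrite /gpdf; case: ifP => // _; exact: normal_pdf_ge0. Qed.

Lemma gpdfE m v y : 0 < v -> gpdf m v y =
  (Num.sqrt (v * pi *+ 2))^-1 * expR (- (y - m) ^+ 2 / (v *+ 2)).
Proof.
move=> v0; rewrite /gpdf v0 /gauss normal_pdfE ?gt_eqF ?sqrtr_gt0//.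
by rewrite /normal_peak /normal_fun sqr_sqrtr// ltW.
Qed.

Lemma measurable_gpdf d (T : measurableType d) (m v y : T -> R) :
  measurable_fun setT m -> measurable_fun setT v -> measurable_fun setT y ->
  measurable_fun setT (fun t => gpdf (m t) (v t) (y t)).
Proof.
move=> mm mv my.
(* On positive arguments an inverse is [expR (- ln _)], which makes the density a composition of
   measurable functions. *)
have -> : (fun t => gpdf (m t) (v t) (y t)) = fun t => if 0 < v t then
   expR (- ln (Num.sqrt (v t * pi *+ 2)))
   * expR (- (y t - m t) ^+ 2 * expR (- ln (v t *+ 2))) else 0.
  apply/funext => t; case: ifPn => v0; last by rewrite /gpdf (negbTE v0).
  have l0 (a : R) : 0 < a -> expR (- ln a) = a^-1.
    by move=> a0; rewrite expRN lnK.
  rewrite gpdfE// !l0// ?sqrtr_gt0 ?mulrn_wgt0//.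
  by rewrite mulr_gt0// pi_gt0.
have msqrt : measurable_fun setT (@Num.sqrt R).
  by apply: continuous_measurable_fun; exact: sqrt_continuous.
apply: measurable_fun_ifT => //.
  exact: measurable_fun_ltr.
apply: measurable_funM; apply: measurableT_comp => //.
  apply: measurableT_comp => //; apply: measurableT_comp => //.
  apply: measurableT_comp => //.
  under eq_fun do rewrite mulr2n.
  by apply: measurable_funD; exact: measurable_funM.
apply: measurable_funM.
  apply: measurableT_comp => //; apply: measurable_funX.
  exact: measurable_funB.
apply: measurableT_comp => //; apply: measurableT_comp => //.
apply: measurableT_comp => //.
under eq_fun do rewrite mulr2n.
exact: measurable_funD.
Qed.

Lemma gpdfN m v y : gpdf m v (- y) = gpdf (- m) v y.
Proof.
have [v0|v0] := ltP 0 v; last by rewrite /gpdf ltNge v0.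
by rewrite !gpdfE//; have -> : (- y - m) ^+ 2 = (y - - m) ^+ 2 by ring.
Qed.

(** If [m * y >= 0] then [y] is at least as close to [m] as [- y] is: the squared distances differ
    by [4 * m * y]. This gives the symmetrized first moment below an integrand of constant sign. *)
Lemma gpdf_mono m v y : 0 < v -> 0 <= m * y -> gpdf m v (- y) <= gpdf m v y.
Proof.
move=> v0 my; rewrite !gpdfE// ler_wpM2l ?invr_ge0 ?sqrtr_ge0// ler_expR.
rewrite ler_pM2r ?invr_gt0 ?mulrn_wgt0// lerN2.
rewrite -subr_ge0.
have -> : (- y - m) ^+ 2 - (y - m) ^+ 2 = (m * y) * 4 by ring.
by rewrite mulr_ge0.
Qed.

(** For [Z] standard normal: integrability and mean of [h(Z)]. Gaussian integrals are pulled back to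
    this fixed law, so that dominating functions of [z] can be uniform in mean and variance. *)
Definition gint h := mu.-integrable setT (fun z => (h z * gpdf 0 1 z)%:E).
Definition gexp h : R := \int[mu]_z (h z * gpdf 0 1 z).

Lemma measurable_gpdfz m v : measurable_fun setT (gpdf m v).
Proof. exact: measurable_gpdf. Qed.

Lemma integral_gpdf m v h : 0 < v -> measurable_fun setT h ->
  (\int[mu]_y (h y * gpdf m v y)%:E =
   \int[mu]_z (h (m + Num.sqrt v * z) * gpdf 0 1 z)%:E)%E.
Proof.
move=> v0 mh; rewrite (@integral_affine m (Num.sqrt v)) ?sqrtr_gt0//.
  apply: eq_integral => z _; congr EFin.
  rewrite mulrCA; congr (_ * _).
  rewrite !gpdfE// mulrA; congr (_ * expR _).
    rewrite -mulrnAr sqrtrM ?ltW// invfM mulrA divff ?mul1r//.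
    by rewrite gt_eqF// sqrtr_gt0.
  rewrite addrAC subrr add0r subr0 exprMn sqr_sqrtr ?ltW//.
  by field; rewrite gt_eqF.
by apply: measurable_funM => //; exact: measurable_gpdfz.
Qed.

Lemma gint1 : gint (fun=> 1).
Proof.
rewrite /gint; under eq_fun do rewrite mul1r /gpdf ltr01 /gauss sqrtr1.
exact: integrable_normal_pdf.
Qed.

Lemma gexp1 : gexp (fun=> 1) = 1.
Proof.
rewrite /gexp /Rintegral.
under eq_integral do rewrite mul1r /gpdf ltr01 /gauss sqrtr1.
by rewrite integral_normal_pdf.
Qed.

Lemma measurable_gintE h : measurable_fun setT h ->
  measurable_fun setT (fun z => (h z * gpdf 0 1 z)%:E).
Proof.
move=> mh; apply/measurable_EFinP; apply: measurable_funM => //.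
exact: measurable_gpdfz.
Qed.

Lemma gint_le h k : measurable_fun setT h -> (forall z, `|h z| <= k z) ->
  gint k -> gint h.
Proof.
move=> mh hk; apply: le_integrable => //; first exact: measurable_gintE.
move=> z _; rewrite !abse_EFin lee_fin !normrM ler_wpM2r//.
by rewrite (le_trans (hk z))// ler_norm.
Qed.

Lemma gintD h k : gint h -> gint k -> gint (fun z => h z + k z).
Proof.
move=> ih ik; rewrite /gint.
by under eq_fun do rewrite mulrDl EFinD; exact: integrableD.
Qed.

Lemma gintZ (c : R) h : gint h -> gint (fun z => c * h z).
Proof.
move=> ih; rewrite /gint.
by under eq_fun do rewrite -mulrA EFinM; exact: integrableZl.
Qed.

Lemma gexpD h k : gint h -> gint k ->
  gexp (fun z => h z + k z) = gexp h + gexp k.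
Proof.
move=> ih ik; rewrite /gexp -RintegralD//.
by apply: eq_Rintegral => z _; rewrite mulrDl.
Qed.

Lemma gexpZ (c : R) h : gint h -> gexp (fun z => c * h z) = c * gexp h.
Proof.
move=> ih; rewrite /gexp -RintegralZl//.
by apply: eq_Rintegral => z _; rewrite mulrA.
Qed.

Lemma gint_sum (I : Type) (r : seq I) (h : I -> R -> R) :
  (forall i, gint (h i)) -> gint (fun z => \sum_(i <- r) h i z).
Proof.
move=> ih; elim: r => [|i r IHr].
  under eq_fun do rewrite big_nil.
  have -> : (fun _ : R => 0 : R) = (fun z => 0 * (fun=> 1) z).
    by apply/funext => z; rewrite mul0r.
  exact/gintZ/gint1.
by under eq_fun do rewrite big_cons; exact: gintD.
Qed.

Lemma gexp_sum (I : Type) (r : seq I) (h : I -> R -> R) :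
  (forall i, gint (h i)) ->
  gexp (fun z => \sum_(i <- r) h i z) = \sum_(i <- r) gexp (h i).
Proof.
move=> ih; elim: r => [|i r IHr].
  under [in LHS]eq_fun do rewrite big_nil.
  rewrite big_nil /gexp.
  under eq_Rintegral do rewrite mul0r.
  by rewrite Rintegral_cst//= mul0r.
rewrite big_cons -IHr -gexpD//; last exact: gint_sum.
by congr gexp; apply/funext => z; rewrite big_cons.
Qed.

Lemma gexp_opp h : measurable_fun setT h -> gexp (fun z => h (- z)) = gexp h.
Proof.
move=> mh; rewrite /gexp /Rintegral; congr fine.
rewrite [RHS]integralN_arg.
  by apply: eq_integral => z _; rewrite gpdfN oppr0.
by apply: measurable_funM => //; exact: measurable_gpdfz.
Qed.

Lemma ler_gexp h k : gint h -> gint k -> (forall z, h z <= k z) ->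
  gexp h <= gexp k.
Proof.
move=> ih ik hk; apply: le_Rintegral => // z _.
by rewrite ler_wpM2r// gpdf_ge0.
Qed.

Lemma gexpE h : gint h -> (\int[mu]_z (h z * gpdf 0 1 z)%:E)%E = (gexp h)%:E.
Proof. by move=> ih; rewrite /gexp /Rintegral fineK// integrable_fin_num. Qed.

(** [|z|^n] is at most [1 + C * exp(z^2 / 4)], and [exp(z^2 / 4)] times the density of [N(0,1)] is
    [sqrt 2] times that of [N(0,2)], which is integrable. *)
Lemma gint_normX n : gint (fun z => `|z| ^+ n).
Proof.
(* This [C] comes from the bound [u^(n+1) / (n+1)! <= exp u] at [u = z^2 / 4], used when [|z| > 1],
   where [|z|^n <= (z^2)^(n+1)]. *)
pose C : R := n.+1`!%:R * 4 ^+ n.+1.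
have C0 : 0 <= C by rewrite mulr_ge0// exprn_ge0.
suff : mu.-integrable setT
    (fun z => (C * Num.sqrt 2)%:E * (gpdf 0 2 z)%:E + (gpdf 0 1 z)%:E)%E.
  apply: le_integrable => //.
    apply: measurable_gintE; apply: measurable_funX.
    exact: normr_measurable.
  move=> z _; rewrite -EFinM -EFinD !abse_EFin lee_fin.
  apply: le_trans (ler_norm _).
  rewrite [leLHS]ger0_norm ?mulr_ge0 ?exprn_ge0 ?gpdf_ge0//.
  have p12 : expR (z ^+ 2 / 4) * gpdf 0 1 z = Num.sqrt 2 * gpdf 0 2 z.
    have e2 : Num.sqrt (2 * pi *+ 2) = Num.sqrt 2 * Num.sqrt (pi *+ 2) :> R.
      by rewrite -mulrnAr sqrtrM.
    rewrite !gpdfE// mul1r subr0 mulrCA -expRD e2 invfM -(mulrA (Num.sqrt 2)^-1).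
    rewrite mulVKf ?gt_eqF ?sqrtr_gt0//.
    by congr (_ * expR _); field.
  have zn : `|z| ^+ n <= 1 + C * expR (z ^+ 2 / 4).
    have [z1|z1] := leP `|z| 1.
      rewrite (@le_trans _ _ 1) ?exprn_ile1//.
      by rewrite lerDl mulr_ge0// expR_ge0.
    apply: (@le_trans _ _ (`|z| ^+ (2 * n.+1))).
      by rewrite ler_weXn2l ?(ltW z1)// mul2n -addnn addSn leqW// leq_addr.
    rewrite exprM real_normK ?num_real//.
    have z40 : 0 <= z ^+ 2 / 4 by rewrite divr_ge0// sqr_ge0.
    have c0 : 0 < n.+1`!%:R * 4 ^+ n.+1 :> R.
      by rewrite mulr_gt0 ?exprn_gt0// ltr0n fact_gt0.
    have := expR_ge1Dxn n z40; rewrite -(ler_pM2l c0) -/C => le.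
    rewrite ler_wpDl// (le_trans _ le)// mulrDr mulr1 ler_wpDl// /C expr_div_n.
    rewrite le_eqVlt; apply/orP; left; apply/eqP; field.
    by rewrite pnatr_eq0 -lt0n fact_gt0 expf_neq0.
  rewrite (le_trans (ler_wpM2r (gpdf_ge0 _ _ _) zn))// mulrDl mul1r.
  by rewrite addrC -mulrA p12 mulrA.
apply: integrableD => //.
  apply: integrableZl => //.
  rewrite (_ : (fun _ => _) = fun z => (normal_pdf 0 (Num.sqrt 2) z)%:E).
    exact: integrable_normal_pdf.
  by apply/funext => z; rewrite /gpdf ltr0n.
have := gint1; rewrite /gint.
by under eq_fun do rewrite mul1r.
Qed.

Lemma gint_poly_norm (p : {poly R}) : gint (fun z => p.[`|z|]).
Proof.
under eq_fun do rewrite horner_coef.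
by apply: gint_sum => i; exact/gintZ/gint_normX.
Qed.

Lemma gint_poly (p : {poly R}) : gint (fun z => p.[z]).
Proof.
under eq_fun do rewrite horner_coef.
apply: gint_sum => i; apply: gintZ; apply: (gint_le _ _ (gint_normX i)).
  exact: measurable_funX.
by move=> z; rewrite normrX.
Qed.

Lemma gexp_odd n : odd n -> gexp (fun z => z ^+ n) = 0.
Proof.
move=> on; have ip : gint (fun z => z ^+ n).
  by have := gint_poly 'X^n; rewrite /gint; under eq_fun do rewrite hornerXn.
have := gexp_opp (measurable_funX n (@measurable_id _ R setT)).
rewrite /= (_ : (fun z => (- z) ^+ n) = fun z => -1 * z ^+ n).
  by rewrite gexpZ// => e; lra.
by apply/funext => z; rewrite exprNn -signr_odd on expr1.
Qed.

End Gaussian.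

(** * Gaussian moments of polynomials *)

Section GaussianPolynomials.
Context {R : realType}.
Notation mu := (@lebesgue_measure R).
Implicit Types (p f : {poly R}) (m v x s r : R).

(** A majorant of [p]: at [v >= |u|] it bounds [|p.[u]|], which turns bounds on a Gaussian variable
    into integrable polynomial bounds. *)
Definition absp p : {poly R} := \poly_(i < size p) `|p`_i|.

Lemma ler_absp p u v : `|u| <= v -> `|p.[u]| <= (absp p).[v].
Proof.
move=> uv; rewrite horner_coef horner_poly (le_trans (ler_norm_sum _ _ _))//.
apply: ler_sum => i _; rewrite normrM normrX ler_wpM2l//.
by rewrite lerXn2r ?nnegrE// (le_trans _ uv).
Qed.

Lemma gint_affine p (a b : R) : gint (fun z => p.[a + b * z]).
Proof.
have := gint_poly (p \Po (a%:P + b *: 'X)); congr gint.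
by apply/funext => z; rewrite horner_comp !hornerE.
Qed.

(* The n-th moment of the normal law with mean [r * x] and variance
   [s * (1 - r ^+ 2)], as a polynomial in [r]: by [gexp_odd] only even powers
   of the standard deviation contribute. *)
Definition hpoly x s n : {poly R} :=
  \sum_(k < n.+1 | ~~ odd k)
    (x ^+ (n - k) * s ^+ k./2 * gexp (fun z => z ^+ k) *+ 'C(n, k)) *:
      ('X^(n - k) * (1 - 'X^2) ^+ k./2).

Lemma horner_hpoly x s n r : 0 <= s -> r ^+ 2 <= 1 ->
  (hpoly x s n).[r] =
  gexp (fun z => (r * x + Num.sqrt (s * (1 - r ^+ 2)) * z) ^+ n).
Proof.
move=> s0 r1; set b := Num.sqrt _.
have b2 : b ^+ 2 = s * (1 - r ^+ 2) by rewrite sqr_sqrtr// mulr_ge0// subr_ge0.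
transitivity (gexp (fun z => \sum_(k < n.+1)
    (((r * x) ^+ (n - k) * b ^+ k) *+ 'C(n, k)) * z ^+ k)); last first.
  congr gexp; apply/funext => z; rewrite exprDn; apply: eq_bigr => k _.
  by rewrite mulrnAl -mulrA -exprMn.
have iX k : gint (fun z : R => z ^+ k).
  by under eq_fun do rewrite -hornerXn; exact: gint_poly.
rewrite gexp_sum; last by move=> k; exact: gintZ.
rewrite /hpoly horner_sum big_mkcond/=; apply: eq_bigr => k _.
rewrite gexpZ//; case: ifPn => [ek|/negPn ok]; last by rewrite gexp_odd// mulr0.
(* For even [k] the square root disappears, which is why the moment is a polynomial in [r]. *)
have -> : b ^+ k = s ^+ k./2 * (1 - r ^+ 2) ^+ k./2.
  by rewrite -exprMn -b2 -exprM mul2n even_halfK.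
have h1 : (1 - 'X^2 : {poly R}).[r] = 1 - r ^+ 2.
  by rewrite hornerD hornerN hornerXn hornerC.
rewrite hornerZ hornerM hornerXn horner_exp h1.
rewrite exprMn !mulrnAl; congr (_ *+ _).
set A := r ^+ _; set B := x ^+ _; set D := s ^+ _; set E := _ ^+ k./2.
by set G := gexp _; ring.
Qed.

Lemma horner_hpoly1 x s n : 0 <= s -> (hpoly x s n).[1] = x ^+ n.
Proof.
move=> s0; rewrite horner_hpoly ?expr1n// subrr mulr0 sqrtr0.
rewrite (_ : (fun _ => _) = fun z => x ^+ n * (fun=> 1) z).
  by rewrite gexpZ ?gexp1 ?mulr1//; exact: gint1.
by apply/funext => z; rewrite mul0r addr0 mul1r mulr1.
Qed.

(** The factor [c] serves both uses: [c = sigma] for the transition kernel and [c = 1] for the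
    jumps. *)
Lemma gexp_horner x s f r (c : R) : 0 <= s -> r ^+ 2 <= 1 ->
  gexp (fun z => f.[c * (r * x + Num.sqrt (s * (1 - r ^+ 2)) * z)]) =
  \sum_(i < size f) f`_i * c ^+ i * (hpoly x s i).[r].
Proof.
move=> s0 r1.
have iX k : gint (fun z => (r * x + Num.sqrt (s * (1 - r ^+ 2)) * z) ^+ k).
  by under eq_fun do rewrite -hornerXn; exact: gint_affine.
under eq_bigr do rewrite horner_hpoly// -gexpZ//.
rewrite -gexp_sum; last by move=> i; exact: gintZ.
congr gexp; apply/funext => z; rewrite horner_coef.
by apply: eq_bigr => i _; rewrite exprMn mulrA.
Qed.

End GaussianPolynomials.

(** * Fubini for Gaussian mixtures and integrals of linear combinations *)

Section Mixture.
Context {R : realType}.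
Notation mu := (@lebesgue_measure R).
Local Notation S := (measurableTypeR R).
Variable nu : {sigma_finite_measure set S -> \bar R}.
Variables (m v : S -> R).
Hypotheses (mm : measurable_fun setT m) (mv : measurable_fun setT v).

(** The integral may be infinite and [a] may be negative; in that case the sign is pulled through
    the integral, whose integrand has constant sign. *)
Let ge0M (a : R) (k : S -> R) : measurable_fun setT k ->
  (forall w, 0 <= k w) ->
  (a%:E * \int[nu]_w (k w)%:E = \int[nu]_w (a * k w)%:E)%E.
Proof.
move=> mk k0.
have mk' : measurable_fun setT (EFin \o k) by exact/measurable_EFinP.
have [a0|a0] := leP 0 a.
  by rewrite -ge0_integralZl//; move=> w _; rewrite lee_fin.
have a0' : 0 <= - a by rewrite oppr_ge0 ltW.
rewrite -[a in LHS]opprK EFinN mulNe -ge0_integralZl//; last first.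
  by move=> w _; rewrite lee_fin.
rewrite -integral_ge0N; last by move=> w _; rewrite -EFinM lee_fin mulr_ge0.
by apply: eq_integral => w _; rewrite -EFinM -EFinN mulNr opprK.
Qed.

(** By Tonelli, the bound [c] on the inner absolute integrals makes the integrand integrable for the
    product measure, and Fubini applies. The mixing measure will be [G sigma] for the transition
    kernel and the Levy measure for the jump density. *)
Lemma gauss_mixture_sigma_finite (h : R -> R) (c : S -> \bar R) :
  measurable_fun setT h -> measurable_fun setT c ->
  (forall w, \int[mu]_y (`|h y| * gpdf (m w) (v w) y)%:E <= c w)%E ->
  (\int[nu]_w c w < +oo)%E ->
  let g y := ((h y)%:E * \int[nu]_w (gpdf (m w) (v w) y)%:E)%E in
  [/\ mu.-integrable setT g,
    measurable_fun setT
      (fun w => \int[mu]_y (h y * gpdf (m w) (v w) y)%:E)%E &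
    (\int[mu]_y g y = \int[nu]_w \int[mu]_y (h y * gpdf (m w) (v w) y)%:E)%E].
Proof.
move=> mh mc hc ci g.
pose F : S * S -> \bar R := fun yw => (h yw.1 * gpdf (m yw.2) (v yw.2) yw.1)%:E.
have mF : measurable_fun setT F.
  apply/measurable_EFinP; apply: measurable_funM.
    exact: (measurableT_comp mh measurable_fst).
  apply: measurable_gpdf => //.
  - exact: (measurableT_comp mm measurable_snd).
  - exact: (measurableT_comp mv measurable_snd).
have gE : g = fun y => (\int[nu]_w F (y, w))%E.
  apply/funext => y; rewrite /g ge0M//; last by move=> w; exact: gpdf_ge0.
  exact: measurable_gpdf.
have iF : (mu \x nu)%E.-integrable setT F.
  apply/(integrable21ltyP _ _ mF); apply: le_lt_trans ci.
  apply: ge0_le_integral => //.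
  - by move=> w _; exact: integral_ge0.
  - apply: (measurable_fun_fubini_tonelli_G (abse \o F)).
      exact: measurableT_comp.
    by move=> z; exact: abse_ge0.
  - move=> w _; apply: le_trans (hc w); rewrite le_eqVlt; apply/orP; left.
    apply/eqP/eq_integral => y _; rewrite /F abse_EFin normrM/=.
    by rewrite (ger0_norm (gpdf_ge0 _ _ _)).
rewrite gE; split; first exact: (integrable_fubini_F iF).
  exact: (measurable_fubini_G iF).
exact: (Fubini iF).
Qed.

End Mixture.

Lemma gauss_mixture (R : realType)
    (nu : {measure set (measurableTypeR R) -> \bar R})
    (m v : measurableTypeR R -> R) (h : R -> R)
    (c : measurableTypeR R -> \bar R) :
  sigma_finite setT nu -> measurable_fun setT m -> measurable_fun setT v ->
  measurable_fun setT h -> measurable_fun setT c ->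
  (forall w, \int[lebesgue_measure]_y (`|h y| * gpdf (m w) (v w) y)%:E <= c w)%E ->
  (\int[nu]_w c w < +oo)%E ->
  let g y := ((h y)%:E * \int[nu]_w (gpdf (m w) (v w) y)%:E)%E in
  [/\ lebesgue_measure.-integrable setT g,
    measurable_fun setT
      (fun w => \int[lebesgue_measure]_y (h y * gpdf (m w) (v w) y)%:E)%E &
    (\int[lebesgue_measure]_y g y =
     \int[nu]_w \int[lebesgue_measure]_y (h y * gpdf (m w) (v w) y)%:E)%E].
Proof.
move=> fnu.
(* Here [nu] is a bare measure with a proof of sigma-finiteness; it is repackaged as a sigma-finite
   measure equal to it. *)
pose H1 := isSFinite.Build _ _ _ _ (sfinite_measure_sigma_finite fnu).
pose H2 := isSigmaFinite.Build _ _ _ _ fnu.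
pose nu' := HB.pack_for (SigmaFiniteMeasure.type (measurableTypeR R) R)
  (Measure.sort nu) H1 H2.
have -> : nu = nu' by exact: eq_measure.
by move=> mm mv mh mc hc ci; exact: (@gauss_mixture_sigma_finite _ nu' _ _ mm mv _ _ mh mc hc ci).
Qed.

Lemma integral_lincomb d (T : measurableType d) (R : realType)
    (mu : {measure set T -> \bar R}) (D : set T) (mD : measurable D)
    (I : Type) (r : seq I) (c e : I -> R) (h : I -> T -> R) :
  (forall i, mu.-integrable D (EFin \o h i)) ->
  (forall i, \int[mu]_(x in D) (h i x)%:E = (e i)%:E)%E ->
  mu.-integrable D (fun x => (\sum_(i <- r) c i * h i x)%:E) /\
  (\int[mu]_(x in D) (\sum_(i <- r) c i * h i x)%:E
   = (\sum_(i <- r) c i * e i)%:E)%E.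
Proof.
move=> ih eh; elim: r => [|i r [IHi IHe]].
  split; first by under eq_fun do rewrite big_nil; exact: integrable0.
  by under eq_integral do rewrite big_nil; rewrite integral0 big_nil.
have iZ : mu.-integrable D (fun x => (c i)%:E * (h i x)%:E)%E.
  by apply: (integrableZl mD); exact: ih.
split.
  by under eq_fun do rewrite big_cons EFinD EFinM; exact: integrableD.
under eq_integral do rewrite big_cons EFinD EFinM.
rewrite integralD//.
by rewrite IHe integralZl// ?eh// ?big_cons//; exact: ih.
Qed.

(** * The transition operator on polynomials *)

Section TransitionPolynomial.
Context {R : realType}.
Notation mu := (@lebesgue_measure R).
Variables (G : R -> probability (measurableTypeR R) R) (psi : R -> R).
Hypothesis G01 : forall sigma, 1 <= sigma -> G sigma `[0, 1]%classic = 1%E.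
Hypothesis Gpsi : has_laplace_exponent G psi.
Hypothesis psi0 : psi 0 = 0.

Let sqrt_in01 (r : R) : r \in `[0, 1] -> 0 <= Num.sqrt r <= 1.
Proof.
rewrite in_itv/= => /andP[r0 r1]; rewrite sqrtr_ge0/= -[leRHS]sqrtr1.
by rewrite ler_wsqrtr.
Qed.

Let measurable_sqrt : measurable_fun setT (@Num.sqrt R).
Proof. by apply: continuous_measurable_fun; exact: sqrt_continuous. Qed.

Lemma integral_sqrt_poly sigma (p : {poly R}) : 1 <= sigma ->
  (G sigma).-integrable `[0, 1] (fun r => (p.[Num.sqrt r])%:E) /\
  (\int[G sigma]_(r in `[0%R, 1%R]) (p.[Num.sqrt r])%:E
   = (\sum_(j < size p) p`_j * sigma `^ (- psi (j%:R / 2)))%:E)%E.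
Proof.
move=> s1.
have := @integral_lincomb _ (measurableTypeR R) R (G sigma) `[0, 1]%classic
  (measurable_itv _) 'I_(size p) (index_enum _) (fun j => p`_j)
  (fun j => sigma `^ (- psi (j%:R / 2))) (fun j r => Num.sqrt r ^+ j).
have -> : (fun x : measurableTypeR R =>
    (\sum_(i <- index_enum 'I_(size p)) p`_i * Num.sqrt x ^+ i)%:E) =
    (fun r => (p.[Num.sqrt r])%:E).
  by apply/funext => r; rewrite horner_coef.
apply.
- move=> j; apply: (@le_integrable _ _ _ _ _ _ _ (cst 1%:E)) => //.
  + apply/measurable_EFinP; apply: measurable_funTS.
    exact: measurable_funX.
  + move=> r /sqrt_in01/andP[r0 r1]; rewrite !abse_EFin lee_fin normr1.
    by rewrite ger0_norm ?exprn_ge0// exprn_ile1.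
  + exact: finite_measure_integrable_cst.
(* The Laplace exponent is given for positive arguments only; at [j = 0] the moment is the total
   mass [1], matched by [psi 0 = 0]. *)
- move=> [[|j] /= _].
    under eq_integral do rewrite expr0.
    rewrite integral_cst//= G01// mul0r psi0 oppr0 powRr0.
    by rewrite mule1.
  rewrite -(Gpsi s1)//.
  apply: eq_integral => r; rewrite inE/= in_itv/= => /andP[r0 _].
  rewrite -powR12_sqrt// -powR_mulrn ?powR_ge0// -powRrM.
  by rewrite mulrC.
Qed.

(** After exchanging the integrals, [gexp_horner] expands the inner one in powers of [sqrt r]. The
    factors [sigma^i] and [sigma^(- psi (j/2))] then combine into one power of [t / s = sigma^2]. *)
Lemma transition_op_horner s t (f : {poly R}) x : 0 < s -> s < t ->
  G (Num.sqrt (t / s)) [set 1] = 0%E ->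
  transition_op G s t (horner f) x =
  (\sum_(i < size f) f`_i * \sum_(j < size (hpoly x s i)) (hpoly x s i)`_j *
     (t / s) `^ ((i%:R - psi (j%:R / 2)) / 2))%:E.
Proof.
move=> s0 st G1; have t0 : 0 < t by exact: lt_trans st.
set sigma := Num.sqrt (t / s).
have ts1 : 1 <= t / s by rewrite ler_pdivlMr// mul1r ltW.
have sg1 : 1 <= sigma by rewrite -[leLHS]sqrtr1 ler_wsqrtr.
have sg0 : 0 <= sigma by rewrite (le_trans _ sg1).
pose m (r : measurableTypeR R) : R := sigma * Num.sqrt r * x.
(* With the value [0] for negative [r], [v r] is positive exactly on [[0, 1[], so [gpdf] itself
   restricts the mixture to that interval. *)
pose v (r : measurableTypeR R) : R := if 0 <= r then t * (1 - r) else 0.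
have mm : measurable_fun setT m.
  by apply: measurable_funM => //; exact: measurable_funM.
have mv : measurable_fun setT v.
  apply: measurable_fun_ifT => //; first exact: measurable_fun_ler.
  by apply: measurable_funM => //; exact: measurable_funB.
have v0 r : 0 < v r -> 0 <= r < 1.
  rewrite /v; case: ifPn; rewrite ?ltxx// => r0.
  by rewrite pmulr_rgt0// subr_gt0.
have v0' r : 0 <= r < 1 -> v r = t * (1 - r) /\ 0 < v r.
  by rewrite /v => /andP[-> r1]; rewrite mulr_gt0// subr_gt0.
(* A bound free of [r]: on [[0, 1[] the mean is at most [sigma * |x|] in absolute value and the
   standard deviation at most [sqrt t]. *)
pose c : R := gexp (fun z => (absp f).[sigma * `|x| + Num.sqrt t * `|z|]).
have ic : gint (fun z => (absp f).[sigma * `|x| + Num.sqrt t * `|z|]).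
  have := gint_poly_norm
    (absp f \Po ((sigma * `|x|)%:P + Num.sqrt t *: 'X)).
  by congr gint; apply/funext => z; rewrite horner_comp !hornerE.
have mh : measurable_fun setT (horner f) by exact: measurable_poly.
have ub r : (\int[mu]_y (`|f.[y]| * gpdf (m r) (v r) y)%:E <= c%:E)%E.
  have [vr|vr] := ltP 0 (v r); last first.
    under eq_integral do rewrite /gpdf ltNge vr mulr0.
    rewrite integral0 lee_fin Rintegral_ge0// => z _.
    rewrite mulr_ge0 ?gpdf_ge0//.
    apply: (le_trans (normr_ge0 f.[sigma * `|x| + Num.sqrt t * `|z|])).
    by apply: ler_absp; rewrite ger0_norm// addr_ge0// mulr_ge0// sqrtr_ge0.
  have /andP[r0 r1] := v0 _ vr; have [vE _] := v0' r ltac:(by rewrite r0).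
  have le z : `|f.[m r + Num.sqrt (v r) * z]| <=
      (absp f).[sigma * `|x| + Num.sqrt t * `|z|].
    apply: ler_absp; rewrite (le_trans (ler_normD _ _))// lerD//.
      rewrite /m !normrM (ger0_norm sg0) ler_wpM2r// ler_piMr//.
      have /andP[? ?] : 0 <= Num.sqrt r <= 1.
        by rewrite sqrt_in01// in_itv/= r0 ltW.
      by rewrite ger0_norm.
    rewrite normrM ler_wpM2r// ger0_norm ?sqrtr_ge0// ler_wsqrtr// vE.
    by rewrite ler_piMr ?(ltW t0)// lerBlDr lerDl.
  have mk : measurable_fun setT (fun z => `|f.[m r + Num.sqrt (v r) * z]|).
    apply: measurableT_comp => //.
    by apply: (measurableT_comp mh); apply: measurable_funD.
  have ik : gint (fun z => `|f.[m r + Num.sqrt (v r) * z]|).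
    by apply: (gint_le mk _ ic) => z; rewrite normr_id.
  rewrite (integral_gpdf _ vr (h := fun y => `|f.[y]|)); last first.
    exact: measurableT_comp.
  by rewrite gexpE// lee_fin ler_gexp.
have cfin : (\int[G sigma]_w (cst c%:E) w < +oo)%E.
  apply: integrable_lty => //.
  exact: (finite_measure_integrable_cst _ c).
have [_ _ mix] := @gauss_mixture _ (G sigma) m v _ _ (sigma_finiteT _) mm mv mh
  (measurable_cst c%:E) ub cfin.
transitivity (\int[mu]_y ((f.[y])%:E *
    \int[G sigma]_w (gpdf (m w) (v w) y)%:E))%E.
  apply: eq_integral => y _; congr (_ * _)%E.
  rewrite /transition_density gt_eqF// integral_mkcond.
  apply: eq_integral => r _; rewrite patchE; case: ifPn.
    rewrite inE/= in_itv/= => r01; have [vE vr] := v0' _ r01.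
    by rewrite /gpdf vr vE.
  rewrite notin_setE/= in_itv/= => /negP r01; rewrite /gpdf; case: ifPn => //.
  by move=> /v0; rewrite (negbTE r01).
rewrite mix.
pose W r : R := \sum_(i < size f) f`_i * sigma ^+ i * (hpoly x s i).[Num.sqrt r].
transitivity (\int[G sigma]_(r in `[0%R, 1%R[) (W r)%:E)%E.
  rewrite [RHS]integral_mkcond; apply: eq_integral => r _; rewrite patchE.
  case: ifPn; last first.
    rewrite notin_setE/= in_itv/= => /negP r01.
    apply: integral0_eq => y _; rewrite /gpdf; case: ifPn; rewrite ?mulr0//.
    by move=> /v0; rewrite (negbTE r01).
  rewrite inE/= in_itv/= => r01; have [vE vr] := v0' _ r01.
  have /andP[r0 r1] := r01.
  rewrite (integral_gpdf _ vr mh) gexpE; last exact: gint_affine.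
  congr EFin; rewrite /W -gexp_horner ?(ltW s0)//; last first.
    by rewrite sqr_sqrtr// ltW.
  (* [t = sigma ^+ 2 * s], so sigma factors out of both the mean and the
     standard deviation. *)
  congr gexp; apply/funext => z; congr (f.[_]).
  rewrite /m mulrDr -!mulrA; congr (_ + _); rewrite mulrA; congr (_ * _).
  rewrite sqr_sqrtr// vE /sigma -sqrtrM ?(le_trans _ ts1)//.
  by congr Num.sqrt; field; rewrite gt_eqF.
have [iW eW] := @integral_lincomb _ (measurableTypeR R) R (G sigma)
  `[0, 1]%classic (measurable_itv _) 'I_(size f) (index_enum _)
  (fun i => f`_i * sigma ^+ i) (fun i => \sum_(j < size (hpoly x s i))
     (hpoly x s i)`_j * sigma `^ (- psi (j%:R / 2)))
  (fun i r => (hpoly x s i).[Num.sqrt r])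
  (fun i => (integral_sqrt_poly (hpoly x s i) sg1).1)
  (fun i => (integral_sqrt_poly (hpoly x s i) sg1).2).
(* The kernel integrates over [[0, 1[] and the moments over [[0, 1]]; the point [1] is null for
   [G sigma]. *)
have -> : `[0%R, 1%R[%classic = `[0, 1]%classic `\` [set 1]
    :> set (measurableTypeR R).
  apply/seteqP; split => r /=; rewrite !in_itv/=.
    by move=> /andP[-> r1]; split; [exact: ltW|apply/eqP; rewrite lt_eqF].
  by move=> [/andP[-> r1] /eqP r1']; rewrite lt_neqAle r1' r1.
rewrite -negligible_integral//; rewrite eW; congr EFin.
apply: eq_bigr => i _; rewrite -mulrA mulr_sumr; congr (_ * _).
apply: eq_bigr => j _; rewrite mulrCA; congr (_ * _).
have ts0 : 0 <= t / s by rewrite (le_trans _ ts1).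
have sgn0 : sigma != 0 by rewrite gt_eqF// (lt_le_trans _ sg1).
rewrite -powR_mulrn// -powRD ?sgn0 ?implybT//.
by rewrite /sigma -powR12_sqrt// -powRrM (mulrC 2^-1).
Qed.

End TransitionPolynomial.

(** * Differentiation of powers of [t / s] at [t = s] *)

Lemma cvg_powR_rate (R : realType) (s a : R) : 0 < s ->
  (t - s)^-1 * ((t / s) `^ a - 1) @[t --> s^'+] --> a / s.
Proof.
move=> s0.
have ss : s / s = 1 by rewrite divff// gt_eqF.
have dp : is_derive (s / s) 1 (fun x : R => x `^ a) (a * (s / s) `^ (a - 1)).
  by apply: is_derive1_powR; rewrite ss.
have dl : is_derive s 1 (fun t : R => t / s) s^-1.
  by apply: is_derive_eq; rewrite scaler0 add0r /GRing.scale/= mulr1.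
have dc := @is_derive1_comp R (fun x : R => x `^ a) (fun t : R => t / s) s _ _ dp dl.
have := @ex_derive _ _ _ _ _ _ _ dc; have := @derive_val _ _ _ _ _ _ _ dc.
rewrite /derive ss powR1 mulr1 => <- /cvgP cv.
(* The derivative is a limit of difference quotients in a nonzero increment [h]; substituting
   [h = t - s] with [t > s] gives the one-sided limit. *)
have sub : (t - s) @[t --> s^'+] --> (0:R)^'.
  move=> A [e /= e0 eA]; exists e => //= t te ts; apply: eA => /=.
    by rewrite sub0r normrN -normrN opprB.
  by rewrite subr_eq0 gt_eqF.
have := cvg_comp _ _ sub cv.
apply: cvg_trans; apply: near_eq_cvg; near=> t.
by rewrite /= ss powR1 /GRing.scale/= mulr1 subrK.
Unshelve. all: by end_near. Qed.

Lemma cvg_sumr (R : realType) (T : Type) (F : set_system T) {FF : Filter F}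
    (n : nat) (f : 'I_n -> T -> R) (l : 'I_n -> R) :
  (forall i, f i x @[x --> F] --> l i) ->
  (\sum_(i < n) f i x) @[x --> F] --> \sum_(i < n) l i.
Proof.
elim: n => [|n IHn] in f l * => fl.
  by under eq_fun do rewrite big_ord0; rewrite big_ord0; exact: cvg_cst.
under eq_fun do rewrite big_ord_recr; rewrite big_ord_recr/=.
by apply: cvgD; [exact: IHn|exact: fl].
Qed.

(** * Integrals against the Levy measure *)

Section LevyIntegrals.
Context {R : realType}.
Variable nu : {measure set (measurableTypeR R) -> \bar R}.
Hypothesis nu_lt0 : nu `]-oo, 0[%classic = 0%E.
Hypothesis nu0 : nu [set 0] = 0%E.
Hypothesis nu_fin : (\int[nu]_(x in `[0%R, +oo[) (Num.min 1 x)%:E < +oo)%E.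

Lemma integrable_min1 :
  nu.-integrable `[0, +oo[ (fun w => (Num.min 1 w)%:E).
Proof.
apply/integrableP; split.
  by apply/measurable_EFinP; exact: measurable_minr.
apply: le_lt_trans nu_fin; rewrite le_eqVlt; apply/orP; left; apply/eqP.
apply: eq_integral => w; rewrite inE/= in_itv/= andbT => w0.
by rewrite ger0_norm// le_min ler01.
Qed.

(** The half-line []-oo, 0]] is null, and [[a, +oo[] has finite mass for [0 < a <= 1] by Markov's
    inequality: [a * nu [a, +oo[] is at most the integral of [min(1, w)]. The sets use
    [a = 1 / (n + 1)]. *)
Lemma sigma_finite_levy : sigma_finite setT nu.
Proof.
exists (fun n => `]-oo, 0[%classic `|` [set 0] `|` `[n.+1%:R^-1, +oo[%classic).
  apply/seteqP; split => // w _.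
  have [w0|w0|->] := ltgtP w 0.
  - by exists 0 => //; left; left; rewrite /= in_itv.
  - have [n _ /(_ n (leqnn _)) nw] := near_infty_natSinv_lt (PosNum w0).
    by exists n => //; right; rewrite /= in_itv/= andbT ltW.
  - by exists 0 => //; left; right.
move=> n; have mn : measurable (`[n.+1%:R^-1, +oo[%classic : set (measurableTypeR R)).
  exact: measurable_itv.
split; first by apply: measurableU => //; exact: measurableU.
have a0 : 0 < n.+1%:R^-1 :> R by rewrite invr_gt0.
have a1 : n.+1%:R^-1 <= 1 :> R by rewrite invf_le1// ler1n.
move: n.+1%:R^-1 mn a0 a1 => a mn a0 a1.
apply: (@le_lt_trans _ _ (nu `[a, +oo[%classic)).
  have m0 : measurable (`]-oo, 0[%classic `|` [set 0] : set (measurableTypeR R)).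
    exact: measurableU.
  have n00 : nu (`]-oo, 0[%classic `|` [set 0]) = 0%E.
    by rewrite null_set_setU.
  apply: (le_trans (measureU2 _ m0 mn)); rewrite -[leRHS]add0e leeD2r//.
  by rewrite le_eqVlt; apply/orP; left; apply/eqP.
have : (a%:E * nu `[a, +oo[%classic < +oo)%E.
  apply: le_lt_trans nu_fin; rewrite -integral_cst//.
  apply: (@le_trans _ _
      (\int[nu]_(x in `[a, +oo[) (Num.min 1 x)%:E)%E).
    apply: ge0_le_integral => //.
    - by move=> w _; rewrite lee_fin ltW.
    - by apply/measurable_EFinP; exact: measurable_minr.
    - move=> w /=; rewrite in_itv/= andbT => nw.
      by rewrite lee_fin le_min nw a1.
  apply: ge0_subset_integral => //.
  - by apply/measurable_EFinP; exact: measurable_minr.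
  - by move=> w /=; rewrite in_itv/= andbT => w0; rewrite lee_fin le_min ler01.
  - move=> w /=; rewrite !in_itv/= !andbT; apply: le_trans; exact: ltW.
rewrite !ltey; apply: contra => /eqP ->.
by rewrite gt0_muley// lte_fin.
Qed.

(** [1 - exp(- u)] is at most [1] and at most [u]; taking [u = l * w] compares it with the
    integrable weight [min(1, w)]. *)
Lemma subr1_expRN_bounds (l w : R) : 0 <= l -> 0 <= w ->
  0 <= 1 - expR (- (l * w)) <= Num.max 1 l * Num.min 1 w.
Proof.
move=> l0 w0; rewrite subr_ge0 -[leRHS]expR0 ler_expR oppr_le0 mulr_ge0//=.
have h1 : 1 - expR (- (l * w)) <= 1 by rewrite lerBlDr lerDl expR_ge0.
have h2 : 1 - expR (- (l * w)) <= l * w.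
  by rewrite lerBlDr -lerBlDl; exact: expR_ge1Dx.
have [w1|w1] := leP 1 w.
  by rewrite mulr1 (le_trans h1)// le_max lexx.
by rewrite (le_trans h2)// ler_wpM2r// le_max lexx orbT.
Qed.

(** Since [exp(- w / 2)^j = exp(- (j / 2) * w)], the difference is the combination, with the
    coefficients of [p], of the integrands defining the Laplace exponent at [j / 2]. *)
Lemma integral_levy_poly (p : {poly R}) :
  nu.-integrable `[0, +oo[ (fun w => (p.[1] - p.[expR (- w / 2)])%:E) /\
  (\int[nu]_(w in `[0%R, +oo[) (p.[1] - p.[expR (- w / 2)])%:E
   = (\sum_(j < size p) p`_j * bernstein_fun 0 nu (j%:R / 2))%:E)%E.
Proof.
pose h (j : 'I_(size p)) (w : measurableTypeR R) := 1 - expR (- (j%:R / 2 * w)).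
have ih j : nu.-integrable `[0, +oo[ (EFin \o h j).
  have j0 : 0 <= j%:R / 2 :> R by rewrite divr_ge0.
  apply: (@le_integrable _ _ _ _ _ _ _
    (fun w : measurableTypeR R =>
      ((Num.max 1 (j%:R / 2))%:E * (Num.min 1 w)%:E)%E)) => //.
  - apply/measurable_EFinP; apply: measurable_funB => //.
    by apply: measurableT_comp => //; apply: measurableT_comp.
  - move=> w /=; rewrite in_itv/= andbT => w0.
    have /andP[h0 h1] := subr1_expRN_bounds j0 w0.
    rewrite !lee_fin ger0_norm// (le_trans h1)//.
    exact: ler_norm.
  - by apply: integrableZl => //; exact: integrable_min1.
have := @integral_lincomb _ (measurableTypeR R) R nu `[0, +oo[%classic
  (measurable_itv _) 'I_(size p) (index_enum _) (fun j => p`_j)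
  (fun j => bernstein_fun 0 nu (j%:R / 2)) h ih.
have -> : (fun x : measurableTypeR R =>
    (\sum_(i <- index_enum 'I_(size p)) p`_i * h i x)%:E) =
    (fun w => (p.[1] - p.[expR (- w / 2)])%:E).
  apply/funext => w; rewrite !horner_coef -sumrB; congr EFin.
  apply: eq_bigr => j _; rewrite /h expr1n mulrBr; congr (_ - _ * _).
  by rewrite -expRM_natl; congr expR; ring.
apply => j; rewrite /bernstein_fun mul0r add0r /Rintegral fineK//.
by apply: integrable_fin_num; [exact: measurable_itv|exact: ih].
Qed.

End LevyIntegrals.

(** * Truncated Gaussian first moments, degenerate variances and Taylor increments *)

Section TruncatedGaussian.
Context {R : realType}.
Notation mu := (@lebesgue_measure R).
Implicit Types (h : R -> R) (m v e : R).

(** The truncation sits in the integrand, so that integrals over [e <= |y|] become integrals over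
    the line and can be pulled back to a standard normal. *)
Definition cut e h y : R := if e <= `|y| then h y else 0.

Lemma measurable_cut e h : measurable_fun setT h -> measurable_fun setT (cut e h).
Proof.
move=> mh; apply: measurable_fun_ifT => //; apply: measurable_fun_ler => //.
Qed.

Lemma normr_cut e h y : `|cut e h y| <= `|h y|.
Proof. by rewrite /cut; case: ifP => // _; rewrite normr0. Qed.

Lemma measurable_comp_affine h m v : measurable_fun setT h ->
  measurable_fun setT (fun z => h (m + Num.sqrt v * z)).
Proof. by move=> mh; apply: (measurableT_comp mh); apply: measurable_funD. Qed.

Lemma Rintegral_gpdf m v h : 0 < v -> measurable_fun setT h ->
  \int[mu]_y (h y * gpdf m v y) = gexp (fun z => h (m + Num.sqrt v * z)).
Proof. by move=> v0 mh; rewrite /Rintegral integral_gpdf. Qed.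

Lemma integrable_gpdf m v h : 0 < v -> measurable_fun setT h ->
  gint (fun z => h (m + Num.sqrt v * z)) ->
  mu.-integrable setT (fun y => (h y * gpdf m v y)%:E).
Proof.
move=> v0 mh ih; have mnh : measurable_fun setT (fun y => `|h y|).
  exact: measurableT_comp.
apply/integrableP; split.
  apply/measurable_EFinP; apply: measurable_funM => //.
  exact: measurable_gpdfz.
under eq_integral do rewrite abse_EFin normrM (ger0_norm (gpdf_ge0 _ _ _)).
rewrite (integral_gpdf _ v0 mnh) gexpE ?ltry//.
apply: (gint_le (k := fun z => `|h (m + Num.sqrt v * z)|)).
- exact: (measurable_comp_affine _ _ mnh).
- by move=> z; rewrite normr_id.
- apply: le_integrable ih => //.
    apply: measurable_gintE; exact: (measurable_comp_affine _ _ mnh).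
  by move=> z _; rewrite !abse_EFin !normrM normr_id.
Qed.

(* By symmetrization, the truncated first moment is the integral over
   [e <= `|y|] of [y * (p y - p (- y)) / 2], whose integrand has constant sign;
   the untruncated one is the mean. *)
Lemma ler_norm_gexp_cut m v e : 0 < v ->
  `|gexp (fun z => cut e id (m + Num.sqrt v * z))| <= `|m|.
Proof.
move=> v0.
have mc e' : measurable_fun setT (cut e' id).
  by apply: measurable_cut; exact: measurable_id.
have iid m' : gint (fun z => m' + Num.sqrt v * z).
  have := gint_affine 'X m' (Num.sqrt v).
  by under [in X in X -> _]eq_fun do rewrite hornerX.
have ic e' m' : gint (fun z => cut e' id (m' + Num.sqrt v * z)).
  apply: le_integrable (iid m') => //.
    by apply: measurable_gintE; apply: measurable_comp_affine.
  move=> z _; rewrite !abse_EFin lee_fin !normrM ler_wpM2r//.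
  exact: normr_cut.
pose I e' m' := \int[mu]_y (cut e' id y * gpdf m' v y).
have IN e' m' : I e' (- m') = - I e' m'.
  rewrite /I !Rintegral_gpdf//.
  rewrite -[LHS](gexp_opp (measurable_comp_affine (- m') v (mc e'))).
  rewrite -[RHS]mulN1r -gexpZ//; congr gexp; apply/funext => z.
  have -> : - m' + Num.sqrt v * - z = - (m' + Num.sqrt v * z) by ring.
  by rewrite /cut normrN /=; case: ifP => _; rewrite ?mulN1r ?oppr0.
(* At level [0] nothing is cut off, and the first moment is the mean. *)
have I0 m' : I 0 m' = m'.
  rewrite /I Rintegral_gpdf// /cut.
  under [X in gexp X]eq_fun do rewrite normr_ge0.
  have -> : (fun z : R => m' + Num.sqrt v * z) =
      (fun z => m' * (fun=> 1) z + Num.sqrt v * z ^+ 1).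
    by apply/funext => z; rewrite mulr1 expr1.
  have iX : gint (fun z : R => z ^+ 1).
    by under eq_fun do rewrite -hornerXn; exact: gint_poly.
  rewrite gexpD; [|exact/gintZ/gint1|exact/gintZ].
  by rewrite !gexpZ// ?gexp1 ?gexp_odd// ?mulr1 ?mulr0 ?addr0//; exact: gint1.
have I2 e' : 2 * I e' m =
    \int[mu]_y (cut e' id y * gpdf m v y - cut e' id y * gpdf (- m) v y).
  rewrite RintegralB//; [|exact: integrable_gpdf|exact: integrable_gpdf].
  by rewrite -/(I e' (- m)) -/(I e' m) IN opprK mulr2n mulrDl mul1r.
(* [k] is a sign of [m]; with it the symmetrized integrand is nonnegative, by [gpdf_mono] at [y] or
   at [- y]. *)
pose k : R := if 0 <= m then 1 else -1.
have km : k * m = `|m|.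
  rewrite /k; case: ifPn => m0; first by rewrite mul1r ger0_norm.
  by rewrite mulN1r ltr0_norm// ltNge.
have kk : k * k = 1 by rewrite /k; case: ifP; rewrite ?mulr1// mulN1r opprK.
have kpos y : 0 <= k * (y * (gpdf m v y - gpdf (- m) v y)).
  have my : m * y = `|m| * (k * y).
    by rewrite -km mulrACA kk mul1r.
  rewrite mulrA -gpdfN; have [u0|u0] := leP 0 (k * y).
    by rewrite mulr_ge0// subr_ge0 gpdf_mono// my mulr_ge0.
  rewrite mulr_le0 ?(ltW u0)// subr_le0 -[in leLHS](opprK y) gpdf_mono//.
  by rewrite mulrN my -mulrN mulr_ge0// oppr_ge0 ltW.
have iB e' : mu.-integrable setT (EFin \o (fun y =>
    cut e' id y * gpdf m v y - cut e' id y * gpdf (- m) v y)).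
  rewrite /comp; under eq_fun do rewrite EFinB.
  by apply: integrableB => //; exact: integrable_gpdf.
have iD e' : mu.-integrable setT (EFin \o (fun y =>
    k * (cut e' id y * gpdf m v y - cut e' id y * gpdf (- m) v y))).
  rewrite /comp; under eq_fun do rewrite EFinM.
  by apply: integrableZl => //; exact: iB.
have cutE e' y : k * (cut e' id y * gpdf m v y - cut e' id y * gpdf (- m) v y)
    = cut e' (fun y => k * (y * (gpdf m v y - gpdf (- m) v y))) y.
  by rewrite -mulrBr /cut; case: ifP => // _; rewrite mul0r mulr0.
have kI e' : k * (2 * I e' m) = \int[mu]_y
    (k * (cut e' id y * gpdf m v y - cut e' id y * gpdf (- m) v y)).
  by rewrite I2 RintegralZl//; exact: iB.
have le0 : 0 <= k * (2 * I e m).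
  rewrite kI Rintegral_ge0// => y _; rewrite cutE /cut; case: ifP => // _.
(* A nonnegative integrand only loses mass when the truncation level rises from [0] to [e]. *)
have leI : k * (2 * I e m) <= k * (2 * I 0 m).
  rewrite !kI; apply: le_Rintegral => // y _; rewrite !cutE /cut normr_ge0.
  by case: ifP.
rewrite -Rintegral_gpdf// -/(I e m).
move: le0 leI; rewrite I0.
have -> : `|I e m| = `|k * I e m|.
  rewrite normrM (_ : `|k| = 1) ?mul1r//.
  by rewrite /k; case: ifP; rewrite ?normrN normr1.
rewrite -km => le0 leI; rewrite ger0_norm; lra.
Qed.

End TruncatedGaussian.

(** For [v <= 0] the square root is [0], and [normal_pdf] with deviation [0] takes the indicator of
    [[0, 1]] as its default value. *)
Lemma gaussE (R : realType) (m v y : R) :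
  gauss m v y = if 0 < v then gpdf m v y else \1_`[0, 1] y.
Proof.
rewrite /gpdf; case: ltP => // v0.
by rewrite /gauss ler0_sqrtr// /normal_pdf eqxx.
Qed.

(** Taylor expansion at [x]: [c] is the degree-one coefficient of the shifted polynomial and [k] its
    quotient by ['X^2]. The linear and quadratic parts need different bounds later. *)
Lemma horner_increment (R : comNzRingType) (f : {poly R}) (x : R) :
  exists c, exists k : {poly R},
    forall y, f.[x + y] - f.[x] = c * y + y ^+ 2 * k.[y].
Proof.
pose F := f \Po (x%:P + 'X).
exists F`_1, (drop_poly 2 F) => y.
have FE z : F.[z] = f.[x + z] by rewrite horner_comp !hornerE.
have F0 : F`_0 = f.[x] by rewrite -horner_coef0 FE addr0.
rewrite -FE -{1}(poly_take_drop 2 F) hornerD hornerM hornerXn (mulrC _ (y ^+ 2)).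
rewrite (_ : (take_poly 2 F).[y] = f.[x] + F`_1 * y); first by ring.
have := @horner_coef_wide _ 2 (take_poly 2 F) y (size_take_poly _ _).
by rewrite !big_ord_recl big_ord0 !coef_take_poly/= => ->; rewrite F0; ring.
Qed.

(** * Bounds of order [min(1, w)] on the effect of a jump *)

Section SmallJumps.
Context {R : realType}.
Notation mu := (@lebesgue_measure R).
Variables (x s : R).
Hypothesis s0 : 0 < s.

(* The increment caused by a jump of size [w] of the subordinator is normal with
   mean [jmean w] and variance [jvar w]; [jump w z] is its value at a standard
   normal [z]. *)
Definition jmean (w : R) : R := (expR (- w / 2) - 1) * x.
Definition jvar (w : R) : R := s * (1 - expR (- w)).
Definition jump (w z : R) : R := jmean w + Num.sqrt (jvar w) * z.
(** Dominates [|jump w z|] for every [w >= 0] at once. *)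
Definition jbound (z : R) : R := `|x| + Num.sqrt s * `|z|.

Lemma jvar_gt0 w : (0 < jvar w) = (0 < w).
Proof. by rewrite /jvar pmulr_rgt0// subr_gt0 -[ltRHS]expR0 ltr_expR oppr_lt0. Qed.

Lemma jbound_ge0 z : 0 <= jbound z.
Proof. by rewrite addr_ge0// mulr_ge0// sqrtr_ge0. Qed.

Lemma gint_jbound (p : {poly R}) : gint (fun z => p.[jbound z]).
Proof.
have := gint_poly_norm (p \Po (`|x|%:P + Num.sqrt s *: 'X)).
by under [in X in X -> _]eq_fun do rewrite horner_comp !hornerE.
Qed.

Lemma jmean_le w : 0 <= w -> `|jmean w| <= Num.min 1 w * `|x|.
Proof.
move=> w0; rewrite normrM ler_wpM2r// distrC.
have h0 : 0 <= 1 / 2 :> R by rewrite divr_ge0.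
have /andP[] := subr1_expRN_bounds h0 w0.
rewrite (_ : - (1 / 2 * w) = - w / 2); last by field.
move=> p0 p1; rewrite ger0_norm// (le_trans p1)//.
rewrite max_l ?mul1r//; lra.
Qed.

Lemma jvar_le w : 0 <= w -> jvar w <= Num.min 1 w * s.
Proof.
move=> w0; rewrite /jvar mulrC ler_wpM2r ?(ltW s0)//.
by have /andP[_] := subr1_expRN_bounds ler01 w0; rewrite mul1r maxxx mul1r.
Qed.

(** With [q = min(1, w) <= 1], the mean is at most [q * |x| <= sqrt q * |x|] and the deviation at
    most [sqrt (q * s)]. Squaring the jump therefore produces the factor [q]. *)
Lemma jump_le w z : 0 <= w ->
  `|jump w z| <= Num.sqrt (Num.min 1 w) * jbound z.
Proof.
move=> w0; set q := Num.min 1 w.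
have q0 : 0 <= q by rewrite le_min ler01.
have q1 : q <= 1 by rewrite ge_min lexx.
rewrite (le_trans (ler_normD _ _))// mulrDr lerD//.
  rewrite (le_trans (jmean_le w0))// ler_wpM2r// -/q.
  rewrite -{1}(sqr_sqrtr q0) expr2 ler_piMr ?sqrtr_ge0//.
  by rewrite -[leRHS]sqrtr1 ler_wsqrtr.
rewrite normrM mulrA ler_wpM2r// ger0_norm ?sqrtr_ge0// -sqrtrM//.
by rewrite ler_wsqrtr// jvar_le.
Qed.

(** The factor [y^2] contributes [min(1, w)] through [jump_le]; the remaining factor is bounded at
    [jbound z], whose polynomials have finite Gaussian mean. *)
Lemma gexp_quadratic (g : R -> R) (p : {poly R}) (w : R) : 0 <= w ->
  measurable_fun setT g -> (forall b, 0 <= b -> 0 <= p.[b]) ->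
  (forall y b, `|y| <= b -> `|g y| <= y ^+ 2 * p.[b]) ->
  gint (fun z => `|g (jump w z)|) /\
  gexp (fun z => `|g (jump w z)|) <=
    Num.min 1 w * gexp (fun z => jbound z ^+ 2 * p.[jbound z]).
Proof.
move=> w0 mg p0 gp; set q := Num.min 1 w.
have q0 : 0 <= q by rewrite le_min ler01.
have q1 : q <= 1 by rewrite ge_min lexx.
have ib : gint (fun z => jbound z ^+ 2 * p.[jbound z]).
  have := gint_jbound ('X^2 * p).
  by under [in X in X -> _]eq_fun do rewrite hornerM hornerXn.
have le z : `|g (jump w z)| <= q * (jbound z ^+ 2 * p.[jbound z]).
  have jl := jump_le z w0.
  have sq : Num.sqrt q <= 1 by rewrite -[leRHS]sqrtr1 ler_wsqrtr.
  have jb : `|jump w z| <= jbound z.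
    by rewrite (le_trans jl)// ler_piMl// jbound_ge0.
  rewrite (le_trans (gp _ _ jb))// mulrA ler_wpM2r ?p0 ?jbound_ge0//.
  rewrite -[leLHS]real_normK ?num_real//.
  rewrite (le_trans (lerXn2r 2 _ _ jl)) ?nnegrE ?mulr_ge0 ?sqrtr_ge0 ?jbound_ge0//.
  by rewrite exprMn sqr_sqrtr.
have ig : gint (fun z => `|g (jump w z)|).
  apply: (gint_le _ _ (gintZ q ib)); last by move=> z; rewrite normr_id.
  by apply: measurableT_comp => //; exact: measurable_comp_affine.
by split=> //; rewrite -gexpZ// ler_gexp//; exact: gintZ.
Qed.

Variable f : {poly R}.
Notation incr := (fun y => f.[x + y] - f.[x]).

Lemma measurable_incr : measurable_fun setT incr.
Proof.
apply: measurable_funB => //.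
apply: (measurableT_comp (measurable_poly f (A := setT))).
exact: measurable_funD.
Qed.

Lemma gint_incr w : gint (fun z => incr (jump w z)).
Proof.
rewrite (_ : (fun z => _) = fun z => (f \Po (x%:P + 'X) - f.[x]%:P).[jump w z]).
  exact: gint_affine.
by apply/funext => z; rewrite hornerD hornerN hornerC horner_comp !hornerE.
Qed.

Lemma gint_cut_incr e w : gint (fun z => cut e incr (jump w z)).
Proof.
apply: le_integrable (gint_incr w) => //.
  apply: measurable_gintE; apply: measurable_comp_affine.
  by apply: measurable_cut; exact: measurable_incr.
move=> z _; rewrite !abse_EFin lee_fin !normrM ler_wpM2r//.
exact: normr_cut.
Qed.

(** Where [e <= |y|], the linear part satisfies [|c * y| <= (|c| / e) * y^2], so the whole increment
    is quadratic. The constant depends on [e], which suffices for exchanging integrals at a fixed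
    truncation. *)
Lemma gexp_norm_cut_incr e : 0 < e -> exists C, forall w, 0 <= w ->
  gexp (fun z => `|cut e incr (jump w z)|) <= C * Num.min 1 w.
Proof.
move=> e0; have [c [k incE]] := horner_increment f x.
pose p := (`|c| / e)%:P + absp k.
exists (gexp (fun z => jbound z ^+ 2 * p.[jbound z])) => w w0.
rewrite mulrC.
have kb0 b : 0 <= b -> 0 <= (absp k).[b].
  by move=> b0; apply: (le_trans (normr_ge0 k.[b])); rewrite ler_absp// ger0_norm.
apply: (gexp_quadratic w0 _ _ _).2.
- by apply: measurable_cut; exact: measurable_incr.
- by move=> b b0; rewrite hornerD hornerC addr_ge0 ?kb0// divr_ge0// ltW.
- move=> y b yb; rewrite /cut; case: ifPn => ey; last first.
    rewrite normr0 mulr_ge0 ?sqr_ge0// hornerD hornerC.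
    have b0 : 0 <= b by rewrite (le_trans _ yb).
    by rewrite addr_ge0 ?kb0// divr_ge0// ltW.
  rewrite incE (le_trans (ler_normD _ _))// hornerD hornerC mulrDr lerD//.
    rewrite normrM mulrCA ler_wpM2l// ler_pdivlMr//.
    by rewrite -(real_normK (num_real y)) expr2 ler_wpM2l.
  by rewrite normrM (ger0_norm (sqr_ge0 _)) ler_wpM2l ?sqr_ge0// ler_absp.
Qed.

(** Here [C] is independent of [e], as the limit [e -> 0] requires. The absolute value stays outside
    the mean, so the linear part benefits from cancellation through [ler_norm_gexp_cut]; only the
    quadratic part is bounded absolutely. *)
Lemma norm_gexp_cut_incr : exists C, forall e w, 0 < w ->
  `|gexp (fun z => cut e incr (jump w z))| <= C * Num.min 1 w.
Proof.
have [c [k incE]] := horner_increment f x.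
exists (`|c| * `|x| + gexp (fun z => jbound z ^+ 2 * (absp k).[jbound z])) => e w w0.
have kb0 b : 0 <= b -> 0 <= (absp k).[b].
  by move=> b0; apply: (le_trans (normr_ge0 k.[b])); rewrite ler_absp// ger0_norm.
pose g y := cut e (fun y => y ^+ 2 * k.[y]) y.
have mg : measurable_fun setT g.
  apply: measurable_cut; apply: measurable_funM; first exact: measurable_funX.
  exact: measurable_poly.
have [ing leg] := gexp_quadratic (ltW w0) mg kb0
  ltac:(by move=> y b yb; rewrite (le_trans (normr_cut _ _ _))// normrM
    (ger0_norm (sqr_ge0 _)) ler_wpM2l ?sqr_ge0// ler_absp).
have ig : gint (fun z => g (jump w z)).
  apply: (gint_le _ _ ing) => //; exact: measurable_comp_affine.
have ii : gint (fun z => cut e id (jump w z)).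
  have := gint_affine 'X (jmean w) (Num.sqrt (jvar w)).
  under [in X in X -> _]eq_fun do rewrite hornerX.
  apply: le_integrable => //.
    apply: measurable_gintE; apply: measurable_comp_affine.
    by apply: measurable_cut; exact: measurable_id.
  move=> z _; rewrite !abse_EFin lee_fin !normrM ler_wpM2r//.
  exact: normr_cut.
have -> : (fun z => cut e incr (jump w z)) =
    (fun z => c * cut e id (jump w z) + g (jump w z)).
  apply/funext => z; rewrite /g /cut; case: ifP => _; first exact: incE.
  by rewrite mulr0 addr0.
rewrite gexpD//; last exact: gintZ.
rewrite gexpZ// (le_trans (ler_normD _ _))// mulrDl lerD//.
  rewrite normrM -mulrA ler_wpM2l//.
  have := ler_norm_gexp_cut (jmean w) e (_ : 0 < jvar w).
  rewrite jvar_gt0 => /(_ w0) /le_trans; apply.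
  by rewrite mulrC jmean_le// ltW.
rewrite mulrC; apply: le_trans leg; rewrite /gexp.
apply: (le_trans (le_normr_Rintegral _ ig)) => //.
apply: le_Rintegral => //.
  by apply: integrable_norm; exact: ig.
by move=> z _; rewrite normrM (ger0_norm (gpdf_ge0 _ _ _)).
Qed.

Lemma cvg_gexp_cut_incr w (u : R^nat) : (forall n, 0 < u n) ->
  u n @[n --> \oo] --> (0 : R) ->
  gexp (fun z => cut (u n) incr (jump w z)) @[n --> \oo] -->
  gexp (fun z => incr (jump w z)).
Proof.
move=> u0 ul.
pose fn n z : \bar R := (cut (u n) incr (jump w z) * gpdf 0 1 z)%:E.
pose F z : \bar R := (incr (jump w z) * gpdf 0 1 z)%:E.
have mi := measurable_incr.
have [|||||_ _ Dg] := @dominated_convergence _ (measurableTypeR R) R mu setT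
  measurableT fn F (abse \o F).
- move=> n; apply: measurable_gintE; apply: measurable_comp_affine.
  exact: measurable_cut.
- by apply: measurable_gintE; exact: (measurable_comp_affine _ _ mi).
(* The sequence is eventually constant: [u n] drops below [|jump w z|], and if the jump is [0] so is
   the increment. *)
- apply: aeW => z _; apply: cvg_near_cst.
  have [j0|j0] := eqVneq (jump w z) 0.
    by apply: nearW => n; rewrite /fn /F /cut j0 addr0 subrr if_same.
  have jp : 0 < `|jump w z| by rewrite normr_gt0.
  have [N _ NA] := (cvgr0Pnorm_lt _).1 ul _ jp; exists N => // n /= Nn.
  have := NA n Nn; rewrite /= gtr0_norm// => un.
  by rewrite /fn /F /cut ltW.
- exact: integrable_abse (gint_incr w).
- apply: aeW => z n _; rewrite /fn /F /= lee_fin !normrM ler_wpM2r//.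
  exact: normr_cut.
have FE : (\int[mu]_z F z = (gexp (fun z => incr (jump w z)))%:E)%E.
  exact: gexpE (gint_incr w).
rewrite FE in Dg; exact: fine_cvg Dg.
Qed.

End SmallJumps.

(** * The singular integral against the jump density *)

Section JumpIntegral.
Context {R : realType}.
Notation mu := (@lebesgue_measure R).
Variable nu : {measure set (measurableTypeR R) -> \bar R}.
Hypothesis nu_lt0 : nu `]-oo, 0[%classic = 0%E.
Hypothesis nu0 : nu [set 0] = 0%E.
Hypothesis nu_fin : (\int[nu]_(x in `[0%R, +oo[) (Num.min 1 x)%:E < +oo)%E.
Variables (x s : R).
Hypothesis s0 : 0 < s.

Lemma measurable_jmean : measurable_fun setT (jmean x : measurableTypeR R -> R).
Proof.
apply: measurable_funM => //; apply: measurable_funB => //.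
by apply: measurableT_comp => //; apply: measurable_funM.
Qed.

Lemma measurable_jvar : measurable_fun setT (jvar s : measurableTypeR R -> R).
Proof.
apply: measurable_funM => //; apply: measurable_funB => //.
by apply: measurableT_comp.
Qed.

(** At [w = 0] the variance vanishes and [gauss] has its default value, but [{0}] is null for [nu].
    For [w <= 0] the right-hand integrand is [0], so the domain can be the whole line. *)
Lemma jump_densityE y : jump_density nu s x y =
  (\int[nu]_w (gpdf (jmean x w) (jvar s w) y)%:E)%E.
Proof.
rewrite /jump_density.
rewrite (@ge0_negligible_integral _ _ _ nu _ [set 0])//; last 2 first.
- apply: measurable_funTS; apply/measurable_EFinP.
  rewrite (_ : (fun _ => _) = fun w : measurableTypeR R => if 0 < jvar s w then
      gpdf (jmean x w) (jvar s w) y else \1_`[0, 1] y).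
    apply: measurable_fun_ifT => //.
      by apply: measurable_fun_ltr => //; exact: measurable_jvar.
    by apply: measurable_gpdf => //; [exact: measurable_jmean|exact: measurable_jvar].
  by apply/funext => w; exact: gaussE.
- by move=> w _; rewrite lee_fin /gauss normal_pdf_ge0.
rewrite integral_mkcond; apply: eq_integral => w _; rewrite patchE.
case: ifPn.
  rewrite inE => -[] /=; rewrite in_itv/= andbT le_eqVlt => /orP[/eqP <-//|w0 _].
  by rewrite gaussE -/(jvar s w) (jvar_gt0 s0) w0.
rewrite notin_setE/= in_itv/= andbT => wn; rewrite /gpdf (jvar_gt0 s0).
case: ltP => // w0; exfalso; apply: wn; split; first exact: ltW.
by apply/eqP; rewrite gt_eqF.
Qed.

Variable f : {poly R}.
Notation incr := (fun y => f.[x + y] - f.[x]).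
Notation jint h w := (\int[mu]_y (h y * gpdf (jmean x w) (jvar s w) y)%:E)%E.

Lemma integral_jump (h : R -> R) w : measurable_fun setT h ->
  gint (fun z => h (jump x s w z)) ->
  jint h w = (if 0 < w then gexp (fun z => h (jump x s w z)) else 0)%:E.
Proof.
move=> mh ih; case: ifPn => w0.
  by rewrite integral_gpdf ?(jvar_gt0 s0)// gexpE.
apply: integral0_eq => y _.
by rewrite /gpdf (jvar_gt0 s0) (negbTE w0) mulr0.
Qed.

Let patch_posE (F : measurableTypeR R -> R) w : F 0 = 0 ->
  ((fun w => (F w)%:E) \_ `[0, +oo[) w = (if 0 < w then F w else 0)%:E.
Proof.
move=> F0; rewrite patchE; case: ifPn => [|]; rewrite ?notin_setE ?inE/= in_itv/= andbT.
  by rewrite le_eqVlt => /orP[/eqP <-|->]//; rewrite ltxx F0.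
by move=> /negP; rewrite -ltNge => w0; rewrite ltNge (ltW w0).
Qed.

Let min1_0 (C : R) : C * Num.min 1 0 = 0.
Proof. by rewrite min_r// mulr0. Qed.

Let levy_integrable (C : R) :
  nu.-integrable setT ((fun w : measurableTypeR R => (C * Num.min 1 w)%:E) \_ `[0, +oo[).
Proof.
have mI : measurable (`[0%R, +oo[%classic : set (measurableTypeR R)).
  exact: measurable_itv.
apply/(integrable_mkcond _ mI).
exact: (integrableZl mI C (integrable_min1 nu_fin)).
Qed.

Lemma measurable_norm_ge (e : R) :
  measurable ([set y | e <= `|y|] : set (measurableTypeR R)).
Proof.
rewrite (_ : [set y | _] = setT `&` (@Num.norm _ R) @^-1` `[e, +oo[).
  exact: (@normr_measurable R setT).
by apply/seteqP; split => y; rewrite /= in_itv/= andbT; [|case].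
Qed.

(** For fixed [e], [gexp_norm_cut_incr] supplies the bound [C * min(1, w)] that [gauss_mixture] asks
    for. *)
Lemma integral_cut_jump e : 0 < e ->
  let g y := ((incr y)%:E * jump_density nu s x y)%E in
  [/\ mu.-integrable [set y | e <= `|y|] g,
    measurable_fun setT (fun w : measurableTypeR R => jint (cut e incr) w) &
    (\int[mu]_(y in [set y | (e <= `|y|)%R]) g y =
     \int[nu]_w jint (cut e incr) w)%E].
Proof.
move=> e0 g.
have mD := measurable_norm_ge e.
have [C hC] := gexp_norm_cut_incr x s0 f e0.
have mc : measurable_fun setT (cut e incr).
  by apply: measurable_cut; exact: measurable_incr.
have mnc : measurable_fun setT (fun y => `|cut e incr y|).
  exact: measurableT_comp.
pose c : measurableTypeR R -> \bar R :=
  (fun w : measurableTypeR R => (C * Num.min 1 w)%:E) \_ `[0, +oo[.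
have ic := levy_integrable C.
have ub w : (\int[mu]_y
    (`|cut e incr y| * gpdf (jmean x w) (jvar s w) y)%:E <= c w)%E.
  rewrite (integral_jump (h := fun y => `|cut e incr y|)).
  - rewrite /c patch_posE//; case: ifPn => // w0.
    by rewrite lee_fin hC// ltW.
  - exact: mnc.
  - apply: le_integrable (gint_cut_incr x s f e w) => //.
      apply: measurable_gintE.
      exact: (measurable_comp_affine _ _ mnc).
    by move=> z _; rewrite !abse_EFin !normrM normr_id.
have [ig mg eg] := gauss_mixture (sigma_finite_levy nu_lt0 nu0 nu_fin)
  measurable_jmean measurable_jvar mc (measurable_int _ ic) ub
  (integrable_lty measurableT ic).
have gE : g \_ [set y | e <= `|y|] = fun y => ((cut e incr y)%:E *
    \int[nu]_w (gpdf (jmean x w) (jvar s w) y)%:E)%E.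
  apply/funext => y; rewrite patchE /g jump_densityE /cut.
  case: ifPn; first by rewrite inE/= => ->.
  by rewrite notin_setE/= => /negP/negbTE ->; rewrite mul0e.
split => //.
  by apply/(integrable_mkcond _ mD); rewrite gE.
by rewrite integral_mkcond gE.
Qed.

(** With [r = exp(- w / 2)], [x] plus the jump has mean [r * x] and variance [s * (1 - r^2)], so its
    moments are the same [hpoly] as for the transition kernel. Integrating over [w] turns powers of
    [r] into values of the Laplace exponent. *)
Lemma integral_off0_jump :
  integral_off0 (fun y => ((incr y)%:E * jump_density nu s x y)%E)
    (\sum_(i < size f) - f`_i * \sum_(j < size (hpoly x s i))
       (hpoly x s i)`_j * bernstein_fun 0 nu (j%:R / 2)).
Proof.
split; first by move=> e e0; have [] := integral_cut_jump e0.
set J := \sum_(i < size f) _.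
pose P w := \sum_(i < size f)
  - f`_i * ((hpoly x s i).[1] - (hpoly x s i).[expR (- w / 2)]).
have PE w : 0 <= w -> gexp (fun z => incr (jump x s w z)) = P w.
  move=> w0; set r := expR (- w / 2).
  have r2 : r ^+ 2 = expR (- w).
    by rewrite /r -expRM_natl; congr expR; field.
  have r1 : r ^+ 2 <= 1 by rewrite r2 -[leRHS]expR0 ler_expR oppr_le0.
  have -> : (fun z => incr (jump x s w z)) = (fun z =>
      f.[1 * (r * x + Num.sqrt (s * (1 - r ^+ 2)) * z)] + - f.[x] * (fun=> 1) z).
    apply/funext => z; rewrite mulr1 mul1r r2; congr (f.[_] - _).
    by rewrite /jump /jmean /jvar -/r; ring.
  rewrite gexpD; last 2 first.
  - by under eq_fun do rewrite mul1r; exact: gint_affine.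
  - by apply: gintZ; exact: gint1.
  rewrite gexp_horner ?(ltW s0)// gexpZ ?gexp1; last exact: gint1.
  rewrite mulr1 horner_coef -sumrB; apply: eq_bigr => i _.
  by rewrite horner_hpoly1 ?(ltW s0)// expr1n; ring.
have [iP eP] := @integral_lincomb _ (measurableTypeR R) R nu
  `[0, +oo[%classic (measurable_itv _) 'I_(size f) (index_enum _)
  (fun i => - f`_i) (fun i => \sum_(j < size (hpoly x s i))
     (hpoly x s i)`_j * bernstein_fun 0 nu (j%:R / 2))
  (fun i w => (hpoly x s i).[1] - (hpoly x s i).[expR (- w / 2)])
  (fun i => (integral_levy_poly nu_fin (hpoly x s i)).1)
  (fun i => (integral_levy_poly nu_fin (hpoly x s i)).2).
rewrite -/J in eP.
have [C hC] := norm_gexp_cut_incr x s0 f.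
have mcut e : measurable_fun setT (cut e incr).
  by apply: measurable_cut; exact: measurable_incr.
(* The limit is taken along arbitrary positive null sequences: after the exchange, dominated
   convergence over [nu] applies with the bound [C * min(1, w)], whose [C] is free of the truncation
   level. *)
have lim (u : R^nat) : (forall n, 0 < u n) -> u n @[n --> \oo] --> (0 : R) ->
    (\int[mu]_(y in [set y | (u n <= `|y|)%R])
      ((incr y)%:E * jump_density nu s x y))%E @[n --> \oo] --> J%:E.
  move=> u0 ul.
  under eq_fun => n do have [_ _ ->] := integral_cut_jump (u0 n).
  rewrite -eP integral_mkcond.
  have [|||||//] := @dominated_convergence _ (measurableTypeR R) R nu setT
    measurableT (fun n w => jint (cut (u n) incr) w)
    ((fun w : measurableTypeR R => (P w)%:E) \_ `[0, +oo[)
    ((fun w : measurableTypeR R => (C * Num.min 1 w)%:E) \_ `[0, +oo[).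
  - by move=> n; have [] := integral_cut_jump (u0 n).
  - apply/(measurable_restrictT _ (measurable_itv _)).
    exact: measurable_int iP.
  - apply: aeW => w _.
    under eq_fun => n do
      rewrite (integral_jump (mcut (u n)) (gint_cut_incr x s f (u n) w)).
    rewrite patch_posE.
      case: ifPn => w0; last exact: cvg_cst.
      rewrite -PE ?ltW//; apply: cvg_EFin; first exact: nearW.
      exact: cvg_gexp_cut_incr.
    rewrite /P big1// => i _.
    by rewrite oppr0 mul0r expR0 subrr mulr0.
  - exact: levy_integrable.
  - apply: aeW => w n _; rewrite (integral_jump (mcut (u n)) (gint_cut_incr x s f (u n) w)).
    rewrite patch_posE//; case: ifPn => w0; last by rewrite abse0.
    by rewrite abse_EFin lee_fin hC.
apply/fine_cvgP; split.
  near=> e; have e0 : 0 < e by near: e; exact: nbhs_right_gt.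
  have [ie _ _] := integral_cut_jump e0.
  by apply: integrable_fin_num ie; exact: measurable_norm_ge.
apply/cvg_at_rightP => u [u0 ul].
exact: fine_cvg (lim u u0 ul).
Unshelve. all: by end_near. Qed.

End JumpIntegral.

(** * The drift term and the assembly of the generator *)

Lemma mulX_horner_deriv (R : comNzRingType) (f : {poly R}) (x : R) :
  x * f^`().[x] = \sum_(i < size f) f`_i * (i%:R * x ^+ i).
Proof.
rewrite -{1}[f]coefK poly_def linear_sum horner_sum mulr_sumr.
apply: eq_bigr => i _; rewrite /= derivZ hornerZ derivXn hornerMn hornerXn.
case: (nat_of_ord i) => [|n] /=; first by rewrite mulr0n mul0r !mulr0.
by rewrite -mulr_natl exprS; ring.
Qed.

Theorem theorem12 (R : realType)
  (G : R -> probability (measurableTypeR R) R)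
  (beta : R) (nu : {measure set (measurableTypeR R) -> \bar R})
  (d : measure_display) (T : measurableType d) (P : probability T R)
  (X : R -> {RV P >-> R})
  (HG : log_convolution_semigroup G)
  (Hlevy : levy_pair beta nu)
  (Hlaplace : has_laplace_exponent G (bernstein_fun beta nu))
  (Hhalf : bernstein_fun beta nu (1 / 2) = 1)
  (HG1 : forall sigma, 1 < sigma -> G sigma [set 1] = 0%E)
  (HX : markov_martingale G X)
  (Hbeta : beta = 0)
  (f : {poly R}) (s x : R) (hs : 0 < s) :
  exists2 J : R,
    integral_off0
      (fun y => ((f.[x + y] - f.[x])%:E * jump_density nu s x y)%E) J &
    generator_is G s (horner f) x
      (x / (2 * s) * f^`().[x] + 1 / (2 * s) * J).
Proof.
have [_ nu_lt0 nu0 nu_fin] := Hlevy; have [G01 _] := HG.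
subst beta; set psi := bernstein_fun 0 nu in Hlaplace.
have psi0 : psi 0 = 0.
  rewrite /psi /bernstein_fun mulr0 add0r.
  under eq_Rintegral do rewrite mul0r oppr0 expR0 subrr.
  by rewrite /Rintegral integral0.
eexists; first exact: (integral_off0_jump nu_lt0 nu0 nu_fin x hs f).
pose b i j := (hpoly x s i)`_j; pose a i j := (i%:R - psi (j%:R / 2)) / 2 : R.
(* The value of [hpoly] at [1] writes [f.[x]] as the double sum for the transition operator with
   every power of [t / s] replaced by [1]. *)
have hx i : x ^+ i = \sum_(j < size (hpoly x s i)) b i j.
  rewrite -(horner_hpoly1 x i (ltW hs)) horner_coef; apply: eq_bigr => j _.
  by rewrite expr1n mulr1.
have fx : f.[x] = \sum_(i < size f) f`_i * \sum_(j < size (hpoly x s i)) b i j.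
  by rewrite horner_coef; apply: eq_bigr => i _; rewrite hx.
set A := (X in generator_is _ _ _ _ X).
(* Each exponent [a i j] splits in two: [i / 2] recombines into [x * f'(x) / 2], and
   [- psi (j / 2) / 2] into half of the singular integral. *)
have AE : A = \sum_(i < size f) f`_i * \sum_(j < size (hpoly x s i))
    b i j * (a i j / s).
  rewrite /A mulrAC mulX_horner_deriv mulr_suml mulr_sumr -big_split/=.
  apply: eq_bigr => i _; rewrite hx /a.
  transitivity (f`_i / (2 * s) * (i%:R * (\sum_(j < size (hpoly x s i)) b i j)
    - \sum_(j < size (hpoly x s i)) b i j * psi (j%:R / 2))).
    by rewrite /b -/psi; ring.
  rewrite mulr_sumr -sumrB !mulr_sumr; apply: eq_bigr => j _.
  by field; rewrite gt_eqF.
have lim : \sum_(i < size f) f`_i * (\sum_(j < size (hpoly x s i))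
    b i j * ((t - s)^-1 * ((t / s) `^ a i j - 1))) @[t --> s^'+] --> A.
  rewrite AE; apply: cvg_sumr => i; apply: cvgMr; apply: cvg_sumr => j.
  by apply: cvgMr; exact: cvg_powR_rate.
have E : \forall t \near s^'+, (((t - s)^-1)%:E *
    (transition_op G s t (horner f) x - (f.[x])%:E))%E =
    (\sum_(i < size f) f`_i * (\sum_(j < size (hpoly x s i))
    b i j * ((t - s)^-1 * ((t / s) `^ a i j - 1))))%:E.
  near=> t; have st : s < t by near: t; exact: nbhs_right_gt.
  rewrite (transition_op_horner G01 Hlaplace psi0 f x hs st); last first.
    (* For [t > s] the parameter [sigma] exceeds [1] strictly, so [G sigma] has no atom at [1]. *)
    have ts1 : 1 < t / s by rewrite ltr_pdivlMr// mul1r.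
    by apply: HG1; rewrite -[ltLHS]sqrtr1 ltr_sqrt// (lt_trans ltr01).
  rewrite fx -EFinB -EFinM; congr EFin.
  rewrite -sumrB mulr_sumr; apply: eq_bigr => i _.
  rewrite -mulrBr -sumrB mulrCA mulr_sumr; congr (_ * _).
  by apply: eq_bigr => j _; rewrite /b /a; ring.
have limE : (\sum_(i < size f) f`_i * (\sum_(j < size (hpoly x s i))
    b i j * ((t - s)^-1 * ((t / s) `^ a i j - 1))))%:E @[t --> s^'+] --> A%:E.
  by apply: cvg_EFin; [apply: nearW|exact: lim].
apply: cvg_trans limE; apply: near_eq_cvg.
by move: E; apply: filterS => t /esym.
Unshelve. all: by end_near. Qed.
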